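(* There is a randomized algorithm for myopic weighted paging with $\ell$ weight classes that is $O(\log \ell)$-competitive (the constant in the $O(\cdot)$ is absolute). Moreover, if all page weights lie in $[1,W]$, then there is a randomized algorithm for myopic weighted paging that is $O(\log\log W)$-competitive.
   Context: Weighted paging: there is a universe of pages, each page $p$ has a weight $w_p>0$, and a cache that holds at most $k$ pages. A request sequence $\sigma=(\sigma_1,\sigma_2,\dots)$ of pages arrives; at each time $t$, after serving the request, the cache must contain $\sigma_t$; loading a page $p$ into the cache costs $w_p$. The instance has $\ell$ weight classes if the page weights take exactly $\ell$ distinct values $w_1,\dots,w_\ell$. Myopic model: when serving the request at time $t$, the algorithm knows $\sigma_1,\dots,\sigma_t$ and, for every pair of pages $p,p'$, which of the two is requested earlier after time $t$, but nothing else about future requests. A randomized algorithm is $c$-competitive if there is a constant $b$ independent of the request sequence such that for every request sequence $\sigma$ its expected cost is at most $c\cdot \mathrm{OPT}(\sigma)+b$, where $\mathrm{OPT}(\sigma)$ is the minimum cost of any offline algorithm serving $\sigma$. *)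

(* Defs.v *)
From HB Require Import structures.
From mathcomp Require Import all_boot all_order all_algebra.
From mathcomp Require Import all_classical all_reals.
From mathcomp Require Import topology normedtype sequences exp measure
  lebesgue_measure lebesgue_integral probability.

Set Implicit Arguments.
Unset Strict Implicit.
Unset Printing Implicit Defensive.

Import Order.TTheory GRing.Theory Num.Theory.
Local Open Scope ring_scope.

(* Requests are indexed 0,1,...,size sigma - 1 (time t of the paper is index t-1). *)
Section Paging.
Variables (R : realType) (P : choiceType).

(* Myopic information at time t: p is requested strictly earlier than p'
   after time t (a page never requested again after t is "at infinity";
   index returns the size of the list when the page is absent). *)
Definition earlier (sigma : seq P) (t : nat) (p p' : P) : bool :=
  (index p (drop t.+1 sigma) < index p' (drop t.+1 sigma))%N.

Definition view (sigma : seq P) (t : nat) : seq (P * (P -> P -> bool)) :=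
  map (fun xi : P * nat => (xi.1, earlier sigma xi.2))
      (zip (take t.+1 sigma) (iota 0 t.+1)).

(* A deterministic myopic algorithm: maps the current view to the cache
   contents after serving the current request (caches are lists read as sets). *)
Definition myopic_alg := seq (P * (P -> P -> bool)) -> seq P.

Definition feasible (k : nat) (sigma : seq P) (cs : seq (seq P)) : bool :=
  all2 (fun x C => (x \in C) && (size (undup C) <= k)%N) sigma cs.

Fixpoint sched_cost (w : P -> R) (C0 : seq P) (cs : seq (seq P)) : R :=
  match cs with
  | [::] => 0
  | C :: cs' => (\sum_(p <- undup C | p \notin C0) w p) + sched_cost w C cs'
  end.

Definition run (A : myopic_alg) (sigma : seq P) : seq (seq P) :=
  map (fun t => A (view sigma t)) (iota 0 (size sigma)).

Definition valid_alg (k : nat) (A : myopic_alg) : Prop :=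
  forall sigma : seq P, feasible k sigma (run A sigma).

Definition alg_cost (w : P -> R) (A : myopic_alg) (sigma : seq P) : R :=
  sched_cost w [::] (run A sigma).

Definition OPT (w : P -> R) (k : nat) (sigma : seq P) : R :=
  inf [set x : R | exists cs, feasible k sigma cs /\ x = sched_cost w [::] cs].

Definition weight_classes (w : P -> R) (l : nat) : Prop :=
  exists s : seq R, [/\ uniq s, size s = l, (forall p, w p \in s)
                      & (forall x, x \in s -> exists p, w p = x)].

Definition rand_competitive (w : P -> R) (k : nat) (c : R) : Prop :=
  exists (d : measure_display) (Omega : measurableType d)
         (Pr : probability Omega R) (A : Omega -> myopic_alg),
    [/\ (forall om, valid_alg k (A om)),
        (forall sigma, measurable_fun setT (fun om => alg_cost w (A om) sigma))
      & exists b : R, forall sigma : seq P,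
          (\int[Pr]_om (alg_cost w (A om) sigma)%:E
             <= (c * OPT w k sigma + b)%:E)%E].

End Paging.

(* Main.v *)
Require Import Defs.
From HB Require Import structures.
From mathcomp Require Import all_boot all_order all_algebra.
From mathcomp Require Import boolp reals.
From mathcomp Require Import zify ring lra.
Set Implicit Arguments.
Unset Strict Implicit.
Unset Printing Implicit Defensive.
Import Order.TTheory GRing.Theory Num.Theory.
Local Open Scope ring_scope.

(* Up to a factor 2 the weights are W 0, W 1, ..., W (n - 1) with
   2 W (j+1) <= W j.  Put M = 2^l >= n.  A fractional solution gives every page
   a level in 0, ..., l+1; a page of level m+1 is missing to the extent
   2^m / M, and a page of level 0 is fully cached.  A request resets the level
   of its page to 0.  While the cache is overfull, let h be the number of pages
   of level <= l minus k; clocks run at unit speed, one for each page of level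
   1, ..., l and, in each class, one for each of the h farthest pages of level
   0.  When a clock of class j reaches W j, its page moves up one level.  The
   cost accrues at rate at most 2 h, since the missing mass is below h and
   n h / M <= h.

   An offline cache K of at most k pages misses at least h of the pages of
   level <= l.  If the pages of level 0 it misses are the farthest ones of their
   class, at least h running clocks belong to missed pages, so the potential,
   the sum over the missed pages of the running time of their clocks until they
   reach level l+1, decreases at rate at least h.  This can be arranged because exchanging, inside a class, a
   page of K for one requested earlier costs the comparator nothing:
   it suffices that every initial segment (by next request) of every class
   contains at least as many pages of K as of the true offline cache.  Each
   offline eviction raises the potential by at most (l+1) times the weight.

   The fractional solution is rounded to M deterministic caches, one of which is
   picked uniformly: copy c devotes to the classes 0, ..., j exactly
   floor ((F j + c) / M) places, where F j is M times the fractional number of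
   cached pages of these classes.  Because the weights are geometric, changing
   one page in one copy costs O(1) times its weight. *)

(** * The fractional solution *)

Lemma minn_sum_leq (I : Type) (s : seq I) (F : I -> nat) (h : nat) :
  (minn (\sum_(i <- s) F i) h <= \sum_(i <- s) minn (F i) h)%N.
Proof.
elim: s => [|x s IH]; first by rewrite !big_nil; lia.
by rewrite !big_cons; lia.
Qed.

Lemma sum_prefix (R : pzRingType) (t c : nat) (x : R) :
  \sum_(i < t) (if (i < c)%N then x else 0) = x *+ minn t c.
Proof.
elim: t => [|t IH]; first by rewrite big_ord0 min0n mulr0n.
rewrite big_ord_recr /= IH; case: ifPn => h.
  have -> : minn t.+1 c = (minn t c).+1 by lia.
  by rewrite mulrSr.
by rewrite addr0; congr (_ *+ _); lia.
Qed.

Lemma sum_count_classes (P : Type) (n : nat) (cls : P -> nat) (a : pred P)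
    (s : seq P) : (forall p, cls p < n)%N ->
  (\sum_(j < n) count (fun y => (cls y == j) && a y) s = count a s)%N.
Proof.
move=> cls_lt; elim: s => [|y s IH] /=; first by rewrite big1.
rewrite big_split /= IH (bigD1 (Ordinal (cls_lt y))) //= eqxx /=.
rewrite big1 ?addn0 // => j; rewrite -val_eqE /= eq_sym => /negPf ->.
by [].
Qed.

Definition upd (P : eqType) (T : Type) (f : P -> T) (y : P) (v : T) : P -> T :=
  fun z => if z == y then v else f z.

Lemma upd_eq (P : eqType) (T : Type) (f : P -> T) y v : upd f y v y = v.
Proof. by rewrite /upd eqxx. Qed.

Lemma upd_neq (P : eqType) (T : Type) (f : P -> T) y v z :
  z != y -> upd f y v z = f z.
Proof. by rewrite /upd => /negPf ->. Qed.

Lemma big_uniqD1 (R : nmodType) (P : eqType) (s : seq P) (y : P)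
    (F : P -> R) : uniq s -> y \in s ->
  \sum_(z <- s) F z = F y + \sum_(z <- s | z != y) F z.
Proof. by move=> us ys; rewrite (bigD1_seq y). Qed.

Lemma count_uniqD1 (P : eqType) (s : seq P) (y : P) (a : pred P) :
  uniq s -> y \in s ->
  (count a s = a y + count (fun z => (z != y) && a z) s)%N.
Proof.
elim: s => //= x s IH /andP[xs us]; rewrite in_cons => /orP[/eqP yx|ys].
  subst y; rewrite eqxx /=; congr (_ + _)%N; apply: eq_in_count => z zs.
  by have -> : z != x by apply: contraNneq xs => <-.
have -> : x != y by apply: contraNneq xs => ->.
by rewrite IH //; lia.
Qed.

Lemma seq_argmin (d : Order.disp_t) (T : eqType) (O : orderType d) (f : T -> O)
    (s : seq T) (x0 : T) : x0 \in s ->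
  exists2 x, x \in s & forall y, y \in s -> (f x <= f y)%O.
Proof.
elim: s x0 => // a s IH x0 _; case: s IH => [_|b s IH].
  by exists a; rewrite ?mem_head // => y; rewrite inE => /eqP ->.
have [x xs xmin] := IH b (mem_head _ _).
have [le_ax|lt_xa] := leP (f a) (f x).
  exists a; first exact: mem_head.
  move=> y; rewrite inE => /orP[/eqP -> //|ys].
  exact: le_trans le_ax (xmin y ys).
exists x; first by rewrite inE xs orbT.
move=> y; rewrite inE => /orP[/eqP ->|ys]; [exact: ltW|exact: xmin].
Qed.

Definition swap (P : eqType) (K : pred P) (y y' : P) : pred P :=
  fun z => if z == y then false else if z == y' then true else K z.

Lemma swap_count (P : eqType) (U : seq P) (K Q : pred P) (y y' : P) :
  uniq U -> y \in U -> y' \in U -> K y -> ~~ K y' ->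
  (count (fun z => swap K y y' z && Q z) U + Q y =
   count (fun z => K z && Q z) U + Q y')%N.
Proof.
move=> uU yU y'U Ky nKy'; have ne : y' != y by apply: contraNneq nKy' => ->.
rewrite (count_uniqD1 _ uU yU) [in RHS](count_uniqD1 _ uU yU).
rewrite (count_uniqD1 _ uU y'U) [in RHS](count_uniqD1 _ uU y'U).
rewrite /swap !eqxx ne Ky (negPf nKy') /=.
set a := count _ _; set b := count _ _; suff -> : a = b by lia.
by apply: eq_count => z /=; do 2 case: eqP.
Qed.

Lemma swap_countN (P : eqType) (U : seq P) (K Q : pred P) (y y' : P) :
  uniq U -> y \in U -> y' \in U -> K y -> ~~ K y' ->
  (count (fun z => Q z && ~~ swap K y y' z) U + Q y' =
   count (fun z => Q z && ~~ K z) U + Q y)%N.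
Proof.
move=> uU yU y'U Ky nKy'.
have E K' : (count Q U = count (fun z => K' z && Q z) U +
                         count (fun z => Q z && ~~ K' z) U)%N.
  by elim: (U) => //= z s ->; case: (Q z); case: (K' z) => /=; lia.
have := swap_count Q uU yU y'U Ky nKy'; move: (E K) (E (swap K y y')); lia.
Qed.

(** * Levels, clocks and the rates of cost and potential *)

Section Fractional.
Variables (R : realFieldType) (P : choiceType) (n : nat) (W : nat -> R).
Variables (cls : P -> nat) (k l : nat).
Hypothesis W_ge0 : forall j, 0 <= W j.
Hypothesis cls_lt : forall p, (cls p < n)%N.
Hypothesis n_le : (n <= 2 ^ l)%N.

(* [pclock st y] is the clock of [y] when [0 < lev st y <= l] (and is
   meaningless otherwise); [sclock st j i] is the clock of the [i]-th farthest
   page of level 0 in class [j], attached to the position and not to the page. *)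
Record fstate := FState {
  pages : seq P;
  lev : P -> nat;
  pclock : P -> R;
  sclock : nat -> nat -> R }.

(* Number of the [2 ^ l] caches that hold a page of level [m]. *)
Definition copies (m : nat) : nat :=
  if m is m'.+1 then (2 ^ l - 2 ^ m')%N else (2 ^ l)%N.

(** [wf_sdecr] makes slot 0 of a class the first to ring. [wf_sout] keeps the slots beyond the
    number of pages empty, so shifting the slots or adding a page brings in no accrued cost. *)
Record wf (st : fstate) : Prop := Wf {
  wf_uniq : uniq (pages st);
  wf_out : forall y, y \notin pages st -> lev st y = l.+1;
  wf_lev : forall y, (lev st y <= l.+1)%N;
  wf_pclock : forall y, 0 <= pclock st y <= W (cls y);
  wf_sclock : forall j i, 0 <= sclock st j i <= W j;
  wf_sdecr : forall j i, sclock st j i.+1 <= sclock st j i;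
  wf_sout : forall j i, (size (pages st) <= i)%N -> sclock st j i = 0 }.

Definition zholes (st : fstate) (K : pred P) (j : nat) : nat :=
  count (fun y => (cls y == j) && ((lev st y == 0%N) && ~~ K y)) (pages st).

Definition part (st : fstate) (y : P) : bool := (0 < lev st y <= l)%N.

(* The pages of level 0 missed by [K] are charged to the first clocks of their
   class, whichever pages they are. *)
Definition Phi (st : fstate) (K : pred P) : R :=
  \sum_(j < n) \sum_(i < zholes st K j) (W j * l.+1%:R - sclock st j i)
  + \sum_(y <- pages st)
      (if part st y && ~~ K y
       then W (cls y) * (l.+1 - lev st y)%:R - pclock st y else 0).

(* Cost that has accrued on the clocks but is not paid yet. *)
Definition Acc (st : fstate) : R :=
  \sum_(j < n) \sum_(i < size (pages st)) sclock st j i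
  + \sum_(y <- pages st)
      (if part st y then pclock st y * (2 ^ (lev st y).-1)%:R else 0).

Definition mass (st : fstate) : nat :=
  (\sum_(y <- pages st) copies (lev st y))%N.

(** Eviction cost scaled by [2 ^ l]; the subtraction is truncated, so only lost copies are
    charged. *)
Definition ecost (st st' : fstate) : R :=
  \sum_(y <- pages st)
     W (cls y) * (copies (lev st y) - copies (lev st' y))%:R.

Lemma copies_le m : (copies m <= 2 ^ l)%N.
Proof. by case: m => //= m; rewrite leq_subr. Qed.

Lemma copies_anti m m' : (m <= m')%N -> (copies m' <= copies m)%N.
Proof.
case: m m' => [|m] [|m'] //= h; first by rewrite leq_subr.
by rewrite leq_sub2l // leq_exp2l.
Qed.

Lemma copies_top : copies l.+1 = 0%N.
Proof. by rewrite /= subnn. Qed.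

(** The page [q] just requested is left out: it must stay at level 0, so no clock runs for it. *)
Definition zcount (st : fstate) (q : P) (j : nat) : nat :=
  count (fun y => (cls y == j) && ((lev st y == 0%N) && (y != q))) (pages st).

Definition ncached (st : fstate) : nat :=
  count (fun y => lev st y <= l)%N (pages st).

Definition excess (st : fstate) : nat := (ncached st - k)%N.

Definition adv (q : P) (tau : R) (st : fstate) : fstate :=
  FState (pages st) (lev st)
    (fun y => if part st y then pclock st y + tau else pclock st y)
    (fun j i => sclock st j i
       + (if (i < minn (excess st) (zcount st q j))%N then tau else 0)).

Lemma zholes_le st (K : pred P) q j : K q -> (zholes st K j <= zcount st q j)%N.
Proof.
move=> Kq; apply: sub_count => y /= /and3P[-> -> nK] /=.
by apply: contraNneq nK => ->.
Qed.

(** A comparator of at most [k] pages misses at least [excess st] of the pages of level at most [l].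
    Truncating the holes class by class keeps at least the truncation of their total. The right-hand
    side is the rate at which [Phi] falls. *)
Lemma excess_holes st (K : pred P) : (count K (pages st) <= k)%N ->
  (excess st <= \sum_(j < n) minn (zholes st K j) (excess st)
    + count (fun y => part st y && ~~ K y) (pages st))%N.
Proof.
move=> cK.
have h1 : (minn (\sum_(j < n) zholes st K j) (excess st) <=
  \sum_(j < n) minn (zholes st K j) (excess st))%N by exact: minn_sum_leq.
have h2 : (\sum_(j < n) zholes st K j =
   count (fun y => (lev st y == 0%N) && ~~ K y) (pages st))%N.
  by apply: sum_count_classes.
have h3 : (ncached st <= count K (pages st) +
   (count (fun y => (lev st y == 0%N) && ~~ K y) (pages st) +
    count (fun y => part st y && ~~ K y) (pages st)))%N.
  rewrite /ncached /part; elim: (pages st) => //= y s IH.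
  by case: (K y); case: (lev st y) => [|m] /=; rewrite ?andbT ?andbF; lia.
apply: leq_trans (leq_add h1 (leqnn _)); rewrite h2 /excess.
move: h3; set a := count (fun y => _ && _) _; set b := count (fun y => part _ _ && _) _.
by lia.
Qed.

Lemma adv_Phi st q tau (K : pred P) : K q -> (count K (pages st) <= k)%N ->
  0 <= tau ->
  Phi (adv q tau st) K <= Phi st K - tau * (excess st)%:R.
Proof.
move=> Kq cK tau0.
have -> : Phi (adv q tau st) K = Phi st K - tau *
   (\sum_(j < n) minn (zholes st K j) (excess st)
    + count (fun y => part st y && ~~ K y) (pages st))%N%:R.
  rewrite /Phi natrD mulrDr opprD addrACA; congr (_ + _).
    rewrite natr_sum mulr_sumr -sumrB; apply: eq_bigr => j _ /=.
    transitivity (\sum_(i < zholes st K j) (W j * l.+1%:R - sclock st j i)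
      - \sum_(i < zholes st K j)
         (if (i < minn (excess st) (zcount st q j))%N then tau else 0)).
      by rewrite -sumrB; apply: eq_bigr => i _; rewrite opprD addrA.
    (* [K q] bounds the holes of the class by [zcount], so every hole charged below the excess has a
       running clock. *)
    rewrite sum_prefix -[tau *+ _]mulr_natr; congr (_ - tau * _%:R).
    by have := zholes_le st j Kq; lia.
  rewrite -sum1_count natr_sum mulr_sumr big_mkcond /= [X in _ - X]big_mkcond /=.
  rewrite -sumrB; apply: eq_bigr => y _.
  rewrite /part /=; case: ifP => /andP; rewrite ?subr0 //.
  by rewrite mulr1 => -[-> _]; rewrite opprD addrA.
rewrite lerD2l lerN2 ler_wpM2l // ler_nat; exact: excess_holes.
Qed.

Lemma copies_compl m : (0 < m <= l)%N -> (copies m + 2 ^ m.-1 = 2 ^ l)%N.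
Proof.
case: m => //= m h; rewrite subnK // leq_exp2l //; lia.
Qed.

(** A page of level at most [l] splits [2 ^ l] into copies held and copies missing. With more than
    [k * 2 ^ l] held, the missing ones number less than [2 ^ l] times the excess. *)
Lemma weight_excess st : wf st -> (k * 2 ^ l < mass st)%N ->
  (\sum_(y <- pages st) (if part st y then 2 ^ (lev st y).-1 else 0)
    <= 2 ^ l * excess st)%N.
Proof.
move=> wfs big.
have : (mass st + \sum_(y <- pages st) (if part st y then 2 ^ (lev st y).-1 else 0)
   <= 2 ^ l * ncached st)%N.
  rewrite /mass /ncached -big_split /= -sum1_count big_distrr /= [X in (_ <= X)%N]big_mkcond /=.
  apply: leq_sum => y _; rewrite /part.
  have := wf_lev wfs y; case: (ltnP (lev st y) l.+1).
    move=> h _; have -> : (lev st y <= l)%N by lia.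
    case: (posnP (lev st y)) => [->|h0] /=; first by rewrite addn0 muln1.
    by rewrite copies_compl ?muln1 // h0; lia.
  move=> h1 h2; have -> : lev st y = l.+1 by lia.
  by rewrite copies_top ltnn.
rewrite /excess mulnBr; lia.
Qed.

(** At most [n * excess st] slots run, each at rate 1, and the page clocks accrue at the rate of the
    missing copies. Both rates are at most [2 ^ l * excess st], which explains the factor
    [2 * 2 ^ l] given to [Phi] later. *)
Lemma adv_Acc st q tau : wf st -> (k * 2 ^ l < mass st)%N -> 0 <= tau ->
  Acc (adv q tau st) <= Acc st + tau * (2 * 2 ^ l * excess st)%N%:R.
Proof.
move=> wfs big tau0.
have -> : Acc (adv q tau st) = Acc st + tau *
  ((\sum_(j < n) minn (size (pages st)) (minn (excess st) (zcount st q j))) +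
   \sum_(y <- pages st) (if part st y then 2 ^ (lev st y).-1 else 0))%N%:R.
  rewrite /Acc natrD mulrDr addrACA; congr (_ + _).
    rewrite natr_sum mulr_sumr -big_split /=; apply: eq_bigr => j _ /=.
    by rewrite big_split /= sum_prefix -[tau *+ _]mulr_natr.
  rewrite natr_sum mulr_sumr -big_split /=; apply: eq_bigr => y _.
  rewrite /part /=; case: (0 < _ <= _)%N; last by rewrite mulr0 addr0.
  by rewrite mulrDl.
rewrite lerD2l ler_wpM2l // ler_nat mulSn mul1n mulnDl leq_add //; last exact: weight_excess.
apply: leq_trans (leq_mul n_le (leqnn (excess st))).
rewrite -[X in (X * _)%N](card_ord n) -sum_nat_const; apply: leq_sum => j _; lia.
Qed.


(** * Running the clocks and firing them *)

Definition slack (st : fstate) (y : P) : R :=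
  W (cls y) - (if lev st y == 0%N then sclock st (cls y) 0 else pclock st y).

Lemma sclock_le0 st j i : wf st -> sclock st j i <= sclock st j 0.
Proof.
move=> wfs; elim: i => // i IH; exact: le_trans (wf_sdecr wfs j i) IH.
Qed.

Lemma part_pages st y : wf st -> part st y -> y \in pages st.
Proof.
move=> wfs /andP[_]; apply: contraLR => /(wf_out wfs) ->.
by rewrite ltnn.
Qed.

Lemma adv_wf st q tau : wf st -> lev st q = 0%N -> 0 <= tau ->
  (forall y, y \in pages st -> (lev st y <= l)%N -> y != q -> tau <= slack st y) ->
  wf (adv q tau st).
Proof.
move=> wfs q0 tau0 tauP; split => //=.
- exact: wf_uniq.
- exact: wf_out.
- exact: wf_lev.
- move=> y; have /andP[h0 h1] := wf_pclock wfs y.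
  case: ifP => hy; last by rewrite h0.
  have /andP[hp hl] := hy.
  have yq : y != q by apply: contraTneq hp => ->; rewrite q0.
  have := tauP y (part_pages wfs hy) hl yq.
  by rewrite /slack gtn_eqF //; lra.
- move=> j i; have /andP[h0 h1] := wf_sclock wfs j i.
  case: ifP => hi; last by rewrite addr0 h0.
  have : (0 < zcount st q j)%N by lia.
  rewrite -has_count => /hasP[y yin /and3P[/eqP yj /eqP y0 yq]].
  have := tauP y yin; rewrite y0 /slack y0 eqxx yj => /(_ isT yq).
  have := sclock_le0 j i wfs; lra.
- move=> j i; have := wf_sdecr wfs j i.
  case: ifP => h1; case: ifP => h2; try lra.
  lia.
- move=> j i si; rewrite (wf_sout wfs j si) add0r ifF //.
  have : (zcount st q j <= size (pages st))%N by exact: count_size.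
  lia.
Qed.


Definition fire_page (y : P) (st : fstate) : fstate :=
  FState (pages st) (upd (lev st) y (lev st y).+1) (upd (pclock st) y 0)
    (sclock st).

Lemma fire_page_wf st y : wf st -> part st y -> wf (fire_page y st).
Proof.
move=> wfs py; have yin := part_pages wfs py.
split => //=; try by case: wfs.
- move=> z zn; rewrite upd_neq; first exact: wf_out.
  by apply: contraNneq zn => ->.
- move=> z; rewrite /upd; case: eqP => _; last exact: wf_lev.
  by case/andP: py.
- move=> z; rewrite /upd; case: eqP => _; last exact: wf_pclock.
  by rewrite lexx W_ge0.
Qed.

(** Rising one level takes one [W (cls y)] off the remaining time, which the full clock had already
    taken off. At level [l] nothing remains and the page leaves the sum. *)
Lemma fire_page_Phi st y (K : pred P) : wf st -> part st y ->
  pclock st y = W (cls y) -> Phi (fire_page y st) K = Phi st K.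
Proof.
move=> wfs py full; have yin := part_pages wfs py.
have /andP[y0 yl] := py.
rewrite /Phi /=; congr (_ + _).
  apply: eq_bigr => j _; have -> // : zholes (fire_page y st) K j = zholes st K j.
  apply: eq_count => z /=; rewrite /upd; case: (eqVneq z y) => // ->.
  by rewrite /= [lev st y == _]gtn_eqF.
rewrite !(big_uniqD1 _ (wf_uniq wfs) yin); congr (_ + _); last first.
  by apply: eq_bigr => z zy; rewrite /part /= !upd_neq.
rewrite /part /= !upd_eq y0 yl /=; case: (K y) => /=; rewrite ?andbF ?andbT //.
case: ifP => h; rewrite full.
  have -> : (l.+1 - lev st y = (l.+1 - (lev st y).+1).+1)%N by lia.
  by rewrite -natr1; lra.
have -> : (l.+1 - lev st y = 1)%N by lia.
lra.
Qed.

(** Rising from a level [m > 0] below [l.+1] loses [2 ^ m.-1] copies, the multiplier of the clock in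
    [Acc], so the full clock pays exactly for them. *)
Lemma fire_page_Acc st y : wf st -> part st y ->
  pclock st y = W (cls y) ->
  ecost st (fire_page y st) + Acc (fire_page y st) = Acc st.
Proof.
move=> wfs py full; have yin := part_pages wfs py.
have /andP[y0 yl] := py.
rewrite /Acc /ecost /= addrCA; congr (_ + _).
rewrite !(big_uniqD1 _ (wf_uniq wfs) yin) addrACA; congr (_ + _); last first.
  rewrite big1 ?add0r; last by move=> z zy; rewrite upd_neq // subnn mulr0.
  by apply: eq_bigr => z zy; rewrite /part /= !upd_neq.
rewrite /part /= !upd_eq y0 yl mul0r if_same addr0 full; congr (_ * _%:R).
case: (lev st y) y0 yl => //= m _ ml.
have : (2 ^ m.+1 <= 2 ^ l)%N by rewrite leq_exp2l.
rewrite expnS; lia.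
Qed.

(** Slot clocks belong to positions: whichever page of the class leaves level 0, slot 0 is the one
    used up and the others move up by one. *)
Definition fire_slot (y : P) (st : fstate) : fstate :=
  FState (pages st) (upd (lev st) y 1%N) (upd (pclock st) y 0)
    (fun j i => if j == cls y then sclock st j i.+1 else sclock st j i).

Lemma fire_slot_wf st y : wf st -> y \in pages st -> wf (fire_slot y st).
Proof.
move=> wfs yin; split => //=; try by case: wfs.
- move=> z zn; rewrite upd_neq; first exact: wf_out.
  by apply: contraNneq zn => ->.
- move=> z; rewrite /upd; case: eqP => _; last exact: wf_lev.
  by [].
- move=> z; rewrite /upd; case: eqP => _; last exact: wf_pclock.
  by rewrite lexx W_ge0.
- by move=> j i; case: ifP => _; exact: wf_sclock.
- by move=> j i; case: ifP => _; exact: wf_sdecr.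
- by move=> j i si; case: ifP => _; apply: (wf_sout wfs) => //; exact: leqW.
Qed.

(** If [K] misses [y], the hole charged to the full slot 0 becomes a page term of equal value and
    the other holes keep their clocks. If [K] holds [y], the shift could put the holes of the class
    on less advanced clocks and raise [Phi]; the last hypothesis excludes this. *)
Lemma fire_slot_Phi st y (K : pred P) : wf st -> y \in pages st -> lev st y = 0%N ->
  sclock st (cls y) 0 = W (cls y) ->
  (K y -> zholes st K (cls y) = 0%N) ->
  Phi (fire_slot y st) K = Phi st K.
Proof.
move=> wfs yin y0 full Kz; rewrite /Phi.
have hz j : (zholes st K j = ((cls y == j) && ~~ K y) + zholes (fire_slot y st) K j)%N.
  rewrite /zholes (count_uniqD1 _ (wf_uniq wfs) yin)
    [in RHS](count_uniqD1 _ (wf_uniq wfs) yin) /= upd_eq y0 /= andbF add0n.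
  congr (_ + _)%N; apply: eq_count => z /=.
  by case: (eqVneq z y) => //= zy; rewrite upd_neq.
rewrite !(big_uniqD1 _ (wf_uniq wfs) yin) /=.
rewrite addrA [RHS]addrA; congr (_ + _); last first.
  by apply: eq_bigr => z zy; rewrite /part /= !upd_neq.
rewrite (bigD1 (Ordinal (cls_lt y))) //=
  [in RHS](bigD1 (Ordinal (cls_lt y))) //= -!addrA [X in _ + X]addrC [X in _ = _ + X]addrC.
rewrite !addrA; congr (_ + _); last first.
  apply: eq_bigr => j jy; rewrite hz.
  have /negPf ne : (cls y != j)%N by rewrite -[j != _]/((j : nat) != cls y) eq_sym in jy.
  by rewrite ne /= add0n; apply: eq_bigr => i _; rewrite eq_sym ne.
rewrite eqxx /part /= !upd_eq y0 /= addr0.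
case: (boolP (K y)) => Ky.
  have z0 : zholes (fire_slot y st) K (cls y) = 0%N.
    by have := hz (cls y); rewrite Kz // eqxx Ky.
  by rewrite z0 Kz // !big_ord0 andbF addr0.
rewrite hz eqxx Ky /= add1n big_ord_recl full andbT subr0 subSS subn0.
(* For [l = 0] level 1 is already the top level and no page term arises. *)
case: (posnP l) => [->|l0]; last by rewrite -natr1; ring.
by rewrite mulr1 subrr add0r addr0.
Qed.

Lemma fire_slot_Acc st y : wf st -> y \in pages st -> lev st y = 0%N ->
  sclock st (cls y) 0 = W (cls y) ->
  ecost st (fire_slot y st) + Acc (fire_slot y st) = Acc st.
Proof.
move=> wfs yin y0 full.
rewrite /Acc /ecost addrCA addrA /=.
rewrite ![X in _ + X = _](big_uniqD1 _ (wf_uniq wfs) yin).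
rewrite ![X in _ = _ + X](big_uniqD1 _ (wf_uniq wfs) yin).
rewrite [X in _ + X + _](big_uniqD1 _ (wf_uniq wfs) yin).
rewrite [X in _ + (_ + X) + _]big1 ?addr0; last first.
  by move=> z zy; rewrite upd_neq // subnn mulr0.
rewrite !addrA; congr (_ + _); last first.
  by apply: eq_bigr => z zy; rewrite /part /= !upd_neq.
rewrite /part /= !upd_eq y0 /= mul0r if_same !addr0.
rewrite (bigD1 (Ordinal (cls_lt y))) //=
  [in RHS](bigD1 (Ordinal (cls_lt y))) //= addrAC; congr (_ + _); last first.
  by apply: eq_bigr => j jy; apply: eq_bigr => i _; rewrite ifF //; apply/negbTE.
have -> : (2 ^ l - (2 ^ l - 2 ^ 0) = 1)%N.
  by have : (0 < 2 ^ l)%N; rewrite ?expn_gt0 // expn0; lia.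
rewrite eqxx mulr1.
have shift (f : nat -> R) m : \sum_(i < m) f i.+1 + f 0 = \sum_(i < m) f i + f m.
  have := @big_ord_recr _ 0 +%R m f; rewrite big_ord_recl addrC => <-.
  by [].
(* The slot shifted in at the end lies beyond the pages, hence is 0. *)
by rewrite -full shift (wf_sout wfs) // addr0.
Qed.

(** * Exchanges in the comparator and eviction steps *)

(* [K'] arises from [K] by exchanging pages for pages of the same class with an
   earlier next request; [e y z] says that [y] is requested before [z]. *)
Definition better (e : rel P) (q : P) (S : seq P) (K K' : pred P) : Prop :=
  K' q /\ forall U, uniq U -> {subset S <= U} ->
    count K' U = count K U /\
    forall Q : pred P,
      (forall y y', cls y = cls y' -> ~~ e y y' -> Q y -> Q y') ->
      (count (fun z => K z && Q z) U <= count (fun z => K' z && Q z) U)%N.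

Lemma better_refl e (q : P) S (K : pred P) : K q -> better e q S K K.
Proof. by []. Qed.

Lemma better_trans e q S K1 K2 K3 :
  better e q S K1 K2 -> better e q S K2 K3 -> better e q S K1 K3.
Proof.
move=> [_ h1] [h h2]; split=> // U uU sU.
have [e1 d1] := h1 U uU sU; have [e2 d2] := h2 U uU sU.
split=> [|Q dQ]; first by rewrite e2.
exact: leq_trans (d1 Q dQ) (d2 Q dQ).
Qed.

Lemma better_swap (e : rel P) q S (K : pred P) y y' : K q -> y != q ->
  y \in S -> y' \in S -> K y -> ~~ K y' -> cls y = cls y' -> ~~ e y y' ->
  better e q S K (swap K y y').
Proof.
move=> Kq yq yS y'S Ky nKy' cyy' nee; split.
  by rewrite /swap eq_sym (negPf yq); case: eqP.
move=> U uU sU; have h Q := swap_count Q uU (sU _ yS) (sU _ y'S) Ky nKy'.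
split=> [|Q dQ].
  have := h predT; rewrite /= !(eq_count (fun z => andbT _)); lia.
move: (h Q) (dQ y y' cyy' nee); case: (Q y); case: (Q y') => /= hQ imp; lia.
Qed.

(** The amortized inequality is required for all comparators [K] at once, since [st'] must be chosen
    without knowing the offline cache; only [K'] may depend on [K]. *)
Definition evict (e : rel P) (q : P) (st st' : fstate) : Prop :=
  [/\ wf st', pages st' = pages st, lev st' q = 0%N,
      (forall y, lev st y <= lev st' y)%N
    & forall K : pred P, K q -> (count K (pages st) <= k)%N ->
      exists2 K', better e q (pages st) K K' &
        ecost st st' + Acc st' + (2 * 2 ^ l)%:R * Phi st' K'
          <= Acc st + (2 * 2 ^ l)%:R * Phi st K].

Lemma ecost_refl st : ecost st st = 0.
Proof. by rewrite /ecost big1 // => y _; rewrite subnn mulr0. Qed.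

Lemma evict_refl e q st : wf st -> lev st q = 0%N -> evict e q st st.
Proof.
move=> wfs q0; split=> // K Kq _; exists K; first exact: better_refl.
by rewrite ecost_refl add0r.
Qed.

Lemma evict_trans e q st1 st2 st3 : wf st1 ->
  evict e q st1 st2 -> evict e q st2 st3 -> evict e q st1 st3.
Proof.
move=> wf1 [wf2 p2 q2 l2 h2] [wf3 p3 q3 l3 h3]; split => //.
- by rewrite p3.
- by move=> y; exact: leq_trans (l2 y) (l3 y).
move=> K Kq cK; have [K2 b2 i2] := h2 K Kq cK.
have [K2q hb2] := b2.
have [e2 _] := hb2 (pages st1) (wf_uniq wf1) (fun _ => id).
have [|K3 b3 i3] := h3 K2 K2q; first by rewrite p2 e2.
rewrite p2 in b3; exists K3; first exact: better_trans b2 b3.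
(* Levels only rise, so the truncated differences of copies add up exactly. *)
suff -> : ecost st1 st3 = ecost st1 st2 + ecost st2 st3 by lra.
rewrite /ecost p2 -big_split /=; apply: eq_bigr => y _.
rewrite -mulrDr -natrD; congr (_ * _%:R).
have := copies_anti (l2 y); have := copies_anti (l3 y); lia.
Qed.

(** The algorithm sees only [e]; the positions [idx] inducing it are known to the analysis alone. *)
Definition compat (e : rel P) (idx : P -> nat) : Prop :=
  forall y z, e y z = (idx y < idx z)%N.

Lemma excess_gt0 st : wf st -> (k * 2 ^ l < mass st)%N -> (0 < excess st)%N.
Proof.
move=> wfs big; suff : (mass st <= ncached st * 2 ^ l)%N.
  rewrite /excess subn_gt0 => h.
  by have := leq_trans big h; rewrite ltn_pmul2r ?expn_gt0.
rewrite /mass /ncached -sum1_count big_distrl /= [X in (_ <= X)%N]big_mkcond /=.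
apply: leq_sum => y _; case: ifPn => h; first by rewrite ?mul1n copies_le.
by have -> : lev st y = l.+1; [have := wf_lev wfs y; lia|rewrite copies_top].
Qed.

Lemma adv_evict e q st tau : wf st -> lev st q = 0%N ->
  (k * 2 ^ l < mass st)%N -> 0 <= tau ->
  (forall y, y \in pages st -> (lev st y <= l)%N -> y != q -> tau <= slack st y) ->
  evict e q st (adv q tau st).
Proof.
move=> wfs q0 big tau0 tauP; split => //; first exact: adv_wf.
move=> K Kq cK; exists K; first exact: better_refl.
have -> : ecost st (adv q tau st) = 0 by exact: ecost_refl.
have := adv_Acc q wfs big tau0; have := adv_Phi Kq cK tau0.
rewrite natrM.
set h := (excess st)%:R; set a := Phi _ _; set b := Phi _ _ => h1 h2.
have m0 : 0 <= (2 * 2 ^ l)%:R :> R by exact: ler0n.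
have := ler_wpM2l m0 h1; lra.
Qed.

(** Counts the level rises still possible; each event uses up at least one, so the eviction loop
    ends. *)
Definition rest (st : fstate) : nat := (\sum_(y <- pages st) (l.+1 - lev st y))%N.

Lemma rest_lt st st' y : pages st' = pages st ->
  (forall z, lev st z <= lev st' z)%N -> y \in pages st ->
  (lev st y <= l)%N -> (lev st y < lev st' y)%N -> (rest st' < rest st)%N.
Proof.
move=> ep mono yin yl lt; rewrite /rest ep.
rewrite [X in (X < _)%N](big_rem y) // [X in (_ < X)%N](big_rem y) //=.
rewrite -addSn leq_add //; first by lia.
by apply: leq_sum => z _; rewrite leq_sub2l.
Qed.

Lemma fire_page_evict e q st y : wf st -> lev st q = 0%N -> part st y ->
  pclock st y = W (cls y) -> evict e q st (fire_page y st).
Proof.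
move=> wfs q0 py full; split => //; first exact: fire_page_wf.
- rewrite /= upd_neq //; apply: contraTneq py => <-.
  by rewrite /part q0.
- by move=> z /=; rewrite /upd; case: eqP => // ->.
move=> K Kq cK; exists K; first exact: better_refl.
by rewrite fire_page_Phi // -(fire_page_Acc wfs py full).
Qed.

(** The critical case is that [K] holds [y] and misses some [y'] of level 0 in the class. As [y] is
    requested last, it may be exchanged for [y']; the number of holes in the class, hence [Phi],
    stays the same, and now [y] is missed. *)
Lemma fire_slot_evict e idx q st y : compat e idx -> wf st ->
  lev st q = 0%N -> y \in pages st -> y != q -> lev st y = 0%N ->
  sclock st (cls y) 0 = W (cls y) ->
  (forall z, z \in pages st -> z != q -> lev st z = 0%N -> cls z = cls y ->
     (idx z <= idx y)%N) ->
  evict e q st (fire_slot y st).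
Proof.
move=> ce wfs q0 yin yq y0 full ymax; split => //; first exact: fire_slot_wf.
- by rewrite /= upd_neq // eq_sym.
- by move=> z /=; rewrite /upd; case: eqP => // ->; rewrite y0.
move=> K Kq cK.
have [Ky|nKy] := boolP (K y); last first.
  exists K; first exact: better_refl.
  by rewrite fire_slot_Phi ?(negPf nKy) // -(fire_slot_Acc wfs yin y0 full).
case: (posnP (zholes st K (cls y))) => [z0|].
  exists K; first exact: better_refl.
  by rewrite fire_slot_Phi // -(fire_slot_Acc wfs yin y0 full).
rewrite -has_count => /hasP[y' y'in /and3P[/eqP cy' /eqP y'0 nKy']].
have y'q : y' != q by apply: contraNneq nKy' => ->.
exists (swap K y y').
  apply: better_swap => //; rewrite ce -leqNgt; exact: ymax.
have nK'y : ~~ swap K y y' y by rewrite /swap eqxx.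
rewrite fire_slot_Phi ?(negPf nK'y) // -(fire_slot_Acc wfs yin y0 full).
suff -> : Phi st (swap K y y') = Phi st K by [].
rewrite /Phi; congr (_ + _).
  apply: eq_bigr => j _; have -> // : zholes st (swap K y y') j = zholes st K j.
  rewrite /zholes; under eq_count do rewrite andbA.
  under [RHS]eq_count do rewrite andbA.
  have := swap_countN (fun z => (cls z == j) && (lev st z == 0%N))
    (wf_uniq wfs) yin y'in Ky nKy'.
  by rewrite y0 y'0 cy' => /addIn.
apply: eq_bigr => z _; rewrite /swap.
case: (eqVneq z y) => [->|_]; first by rewrite /part y0.
by case: (eqVneq z y') => [->|_]; first by rewrite /part y'0.
Qed.

Lemma evict_event e idx q st : compat e idx -> (0 < k)%N -> wf st ->
  q \in pages st -> lev st q = 0%N -> (k * 2 ^ l < mass st)%N ->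
  exists2 st', evict e q st st' & (rest st' < rest st)%N.
Proof.
move=> ce k0 wfs qin q0 big; have exc := excess_gt0 wfs big.
pose s := [seq y <- pages st | (lev st y <= l)%N && (y != q)].
(* The excess is positive and [0 < k], so a page other than [q] has level at most [l]. *)
have [x0 x0s] : exists x0, x0 \in s.
  have : (0 < size s)%N.
    rewrite size_filter; move: exc; rewrite /excess /ncached.
    rewrite (count_uniqD1 _ (wf_uniq wfs) qin).
    rewrite (eq_count (a2 := fun y => (lev st y <= l)%N && (y != q))); last first.
      by move=> z; rewrite andbC.
    by case: (lev st q <= l)%N => /=; lia.
  by case: (s) => // x s' _; exists x; exact: mem_head.
have [x xs xmin] := seq_argmin (slack st) x0s.
move: xs; rewrite mem_filter => /andP[/andP[xl xq] xin].
(* Time runs until the first clock rings; at level 0 [slack] looks at slot 0, the most advanced of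
   the class. *)
pose tau := slack st x.
have tau0 : 0 <= tau.
  rewrite /tau /slack; have /andP[_ h1] := wf_pclock wfs x.
  have /andP[_ h2] := wf_sclock wfs (cls x) 0; case: ifP => _; lra.
have tauP y : y \in pages st -> (lev st y <= l)%N -> y != q -> tau <= slack st y.
  by move=> yin yl yq; apply: xmin; rewrite mem_filter yl yq.
have ea := adv_evict e wfs q0 big tau0 tauP.
have wfa := adv_wf wfs q0 tau0 tauP.
have [x1|x1] := posnP (lev st x).
  pose s0 := [seq z <- pages st | [&& lev st z == 0%N, z != q & cls z == cls x]].
  have xs0 : x \in s0 by rewrite mem_filter x1 xq !eqxx.
  (* The dual order [nat^d] turns the minimum into a maximum: the page fired is the farthest of the
     class, which need not be [x]. *)
  have [y ys0 ymax] := seq_argmin (fun z => idx z : nat^d) xs0.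
  move: ys0; rewrite mem_filter => /andP[/and3P[/eqP y0 yq /eqP yx] yin].
  exists (fire_slot y (adv q tau st)).
    apply: evict_trans ea _ => //; apply: (fire_slot_evict ce) => //=.
      rewrite yx ifT; first by rewrite /tau /slack x1 eqxx addrC subrK.
      have : (0 < zcount st q (cls x))%N.
        by rewrite -has_count; apply/hasP; exists x; rewrite ?x1 ?eqxx.
      lia.
    move=> z zin zq z0 zy; apply: ymax.
    by rewrite mem_filter z0 zq zin zy yx !eqxx.
  apply: (@rest_lt _ _ y) => //=; rewrite ?y0 ?upd_eq //.
  by move=> z; rewrite /upd; case: eqP => // ->; rewrite y0.
have px : part st x by rewrite /part x1.
exists (fire_page x (adv q tau st)).
  apply: evict_trans ea _ => //; apply: fire_page_evict => //=.
  by rewrite px /tau /slack gtn_eqF // addrC subrK.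
apply: (@rest_lt _ _ x) => //=; rewrite ?upd_eq //.
by move=> z; rewrite /upd; case: eqP => // ->.
Qed.

Lemma evict_exists e idx q st : compat e idx -> (0 < k)%N -> wf st ->
  q \in pages st -> lev st q = 0%N ->
  exists2 st', evict e q st st' & (mass st' <= k * 2 ^ l)%N.
Proof.
move=> ce k0; have [m] := ubnP (rest st).
elim: m st => // m IH st hm wfs qin q0.
have [small|big] := leqP (mass st) (k * 2 ^ l).
  by exists st => //; exact: evict_refl.
have [st1 ev1 lt1] := evict_event ce k0 wfs qin q0 big.
have [wf1 p1 q1 _ _] := ev1.
have [||st2 ev2 m2] := IH st1 _ wf1 _ q1; first by lia.
  by rewrite p1.
by exists st2 => //; exact: evict_trans ev1 ev2.
Qed.

(** * Serving a request and changing the comparator *)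

Definition request (q : P) (st : fstate) : fstate :=
  FState (if q \in pages st then pages st else q :: pages st)
    (upd (lev st) q 0%N) (upd (pclock st) q 0) (sclock st).

Lemma request_pages q st z :
  (z \in pages (request q st)) = (z == q) || (z \in pages st).
Proof.
rewrite /=; case: ifP => h; last by rewrite inE.
by case: eqP => // ->.
Qed.

Lemma request_wf q st : wf st -> wf (request q st).
Proof.
move=> wfs; split; try by case: wfs.
- rewrite /=; case: ifP => h; first exact: wf_uniq.
  by rewrite /= h (wf_uniq wfs).
- move=> y; rewrite request_pages negb_or => /andP[yq yn] /=.
  by rewrite upd_neq //; exact: wf_out.
- by move=> y /=; rewrite /upd; case: eqP => // _; exact: wf_lev.
- move=> y /=; rewrite /upd; case: eqP => // _; last exact: wf_pclock.
  by rewrite lexx W_ge0.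
- move=> j i /= h; apply: (wf_sout wfs); move: h.
  by case: ifP => // _; exact: ltnW.
Qed.

Lemma request_Phi q st (K : pred P) : wf st -> K q ->
  Phi (request q st) K = Phi st K.
Proof.
move=> wfs Kq; rewrite /Phi.
have hz j : zholes (request q st) K j = zholes st K j.
  rewrite /zholes /=; case: ifP => _ /=; rewrite ?upd_eq ?Kq ?andbF ?add0n;
  apply: eq_count => z /=; rewrite /upd; case: (eqVneq z q) => // ->;
  by rewrite Kq !andbF.
congr (_ + _); first by apply: eq_bigr => j _; rewrite hz.
rewrite /=; case: ifP => _; rewrite ?big_cons ?Kq ?andbF ?add0r;
apply: eq_bigr => z _; rewrite /part /= /upd; case: (eqVneq z q) => // ->;
by rewrite Kq !andbF.
Qed.

Lemma page_acc_ge0 st y : wf st ->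
  0 <= (if part st y then pclock st y * (2 ^ (lev st y).-1)%:R else 0 : R).
Proof.
move=> wfs; case: ifP => // _; rewrite mulr_ge0 ?ler0n //.
by case/andP: (wf_pclock wfs y).
Qed.

(** The clock of [q] is discarded and a new page only adds an empty slot. *)
Lemma request_Acc q st : wf st -> Acc (request q st) <= Acc st.
Proof.
move=> wfs; rewrite /Acc; apply: lerD.
  apply: ler_sum => j _ /=; case: ifP => // _ /=.
  by rewrite big_ord_recr /= (wf_sout wfs) // addr0.
have h (r : seq P) :
  \sum_(y <- r) (if part (request q st) y
      then pclock (request q st) y * (2 ^ (lev (request q st) y).-1)%:R else 0) <=
  \sum_(y <- r) (if part st y then pclock st y * (2 ^ (lev st y).-1)%:R else 0).
  apply: ler_sum => y _; rewrite {1}/part /= /upd; case: (eqVneq y q) => // _.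
  exact: page_acc_ge0.
rewrite [pages (request q st)]/=; case: ifP => _; first exact: h.
by rewrite big_cons {1}/part /= upd_eq /= add0r; exact: h.
Qed.

Lemma Acc_ge0 st : wf st -> 0 <= Acc st.
Proof.
move=> wfs; rewrite addr_ge0 //.
  apply: sumr_ge0 => j _; apply: sumr_ge0 => i _.
  by case/andP: (wf_sclock wfs j i).
by apply: sumr_ge0 => y _; exact: page_acc_ge0.
Qed.

Lemma slot_term st j i : wf st ->
  0 <= W j * l.+1%:R - sclock st j i <= W j * l.+1%:R.
Proof.
move=> wfs; have /andP[h0 h1] := wf_sclock wfs j i.
have : W j * 1 <= W j * l.+1%:R by rewrite ler_wpM2l // ler1n.
by move=> h; apply/andP; split; lra.
Qed.

Lemma page_term st y : wf st -> part st y ->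
  0 <= W (cls y) * (l.+1 - lev st y)%:R - pclock st y <= W (cls y) * l.+1%:R.
Proof.
move=> wfs /andP[y0 yl]; have /andP[h0 h1] := wf_pclock wfs y.
have : W (cls y) * 1 <= W (cls y) * (l.+1 - lev st y)%:R.
  by rewrite ler_wpM2l // ler1n subn_gt0.
have : W (cls y) * (l.+1 - lev st y)%:R <= W (cls y) * l.+1%:R.
  by rewrite ler_wpM2l // ler_nat leq_subr.
by move=> h h'; apply/andP; split; lra.
Qed.

Lemma Phi_ge0 st K : wf st -> 0 <= Phi st K.
Proof.
move=> wfs; rewrite addr_ge0 //.
  apply: sumr_ge0 => j _; apply: sumr_ge0 => i _.
  by case/andP: (slot_term j i wfs).
apply: sumr_ge0 => y _; case: ifP => // /andP[py _].
by case/andP: (page_term wfs py).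
Qed.

(** Holes are charged to positions, so dropping [y] from the comparator adds at most one term, for
    the next slot of the class or for [y] itself. Each term lies between 0 and
    [W (cls y) * l.+1%:R]. *)
Lemma Phi_delta st (K1 K2 : pred P) y : wf st ->
  ~~ K1 y -> K2 y -> (forall z, z != y -> K1 z = K2 z) ->
  Phi st K2 <= Phi st K1 <= Phi st K2 + W (cls y) * l.+1%:R.
Proof.
move=> wfs nK1 K2y agree.
have WL : 0 <= W (cls y) * l.+1%:R by rewrite mulr_ge0 ?ler0n.
have [yin|yout] := boolP (y \in pages st); last first.
  suff -> : Phi st K1 = Phi st K2 by rewrite lexx lerDl.
  rewrite /Phi; congr (_ + _).
    apply: eq_bigr => j _; have -> // : zholes st K1 j = zholes st K2 j.
    apply: eq_in_count => z zin /=; rewrite agree //.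
    by apply: contraNneq yout => <-.
  rewrite !big_seq; apply: eq_bigr => z zin; rewrite agree //.
  by apply: contraNneq yout => <-.
have hz j : (zholes st K1 j =
    ((cls y == j) && (lev st y == 0)) + zholes st K2 j)%N.
  rewrite /zholes (count_uniqD1 _ (wf_uniq wfs) yin)
    [in RHS](count_uniqD1 _ (wf_uniq wfs) yin) nK1 K2y !andbF andbT add0n.
  congr (_ + _)%N; apply: eq_count => z /=.
  by case: (eqVneq z y) => //= zy; rewrite agree.
rewrite /Phi !(big_uniqD1 _ (wf_uniq wfs) yin) nK1 K2y andbF andbT add0r.
have -> : \sum_(z <- pages st | z != y) (if part st z && ~~ K1 z
    then W (cls z) * (l.+1 - lev st z)%:R - pclock st z else 0) =
  \sum_(z <- pages st | z != y) (if part st z && ~~ K2 z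
    then W (cls z) * (l.+1 - lev st z)%:R - pclock st z else 0).
  by apply: eq_bigr => z zy; rewrite agree.
set S := \sum_(z <- pages st | z != y) _.
rewrite [\sum_(j < n) \sum_(i < zholes st K1 j) _](bigD1 (Ordinal (cls_lt y))) //=.
rewrite [\sum_(j < n) \sum_(i < zholes st K2 j) _](bigD1 (Ordinal (cls_lt y))) //=.
set T := \sum_(i < n | _) \sum_(i0 < zholes st K2 i) _.
rewrite [\sum_(i < n | _) \sum_(i0 < zholes st K1 i) _](_ : _ = T); last first.
  apply: eq_bigr => j jy; rewrite hz.
  have /negPf -> : (cls y != j)%N by rewrite -[j != _]/((j : nat) != cls y) eq_sym in jy.
  by rewrite add0n.
rewrite hz eqxx /=.
have [y0|y0] := eqVneq (lev st y) 0%N.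
  rewrite /part y0 /= add1n big_ord_recr /= add0r.
  by have /andP[h1 h2] := slot_term (cls y) (zholes st K2 (cls y)) wfs;
     apply/andP; split; lra.
rewrite add0n; case: ifP => py; last by rewrite add0r; apply/andP; split; lra.
by have /andP[h1 h2] := page_term wfs py; apply/andP; split; lra.
Qed.

End Fractional.

(** * Rounding to finitely many caches *)

Section Rounding.
Variables (R : realFieldType) (P : choiceType) (n : nat) (W : nat -> R).
Variables (cls : P -> nat) (M : nat).
Hypothesis W_ge0 : forall j, 0 <= W j.
Hypothesis W_geom : forall j, W j.+1 *+ 2 <= W j.
Hypothesis cls_lt : forall p, (cls p < n)%N.
Hypothesis M_gt0 : (0 < M)%N.
Variable U : seq P.
Hypothesis uU : uniq U.

Implicit Types (f : P -> nat) (G g : P -> {set 'I_M}) (j : nat) (c a b : 'I_M).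

Definition cum f j : nat := (\sum_(y <- U | (cls y < j)%N) f y)%N.

(* As [c] ranges over the copies the targets of a class differ by at most 1 and
   average to its fractional number of cached pages. *)
Definition target f j (c : nat) : nat :=
  ((cum f j.+1 + c) %/ M - (cum f j + c) %/ M)%N.

Definition class_row G j c : nat := count (fun y => (cls y == j) && (c \in G y)) U.

Definition consistent f G : Prop :=
  (forall y, y \in U -> #|G y| = f y) /\ (forall j c, class_row G j c = target f j c).

Lemma cum_mono f j : (cum f j <= cum f j.+1)%N.
Proof.
rewrite /cum big_mkcond [X in (_ <= X)%N]big_mkcond /=; apply: leq_sum => y _.
by case: (boolP (cls y < j)%N) => // h; rewrite (leqW h).
Qed.

Lemma targetE f j (c : nat) :
  (target f j c + (cum f j + c) %/ M = (cum f j.+1 + c) %/ M)%N.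
Proof. by rewrite subnK // leq_div2r // leq_add2r cum_mono. Qed.

(** The difference of the two floors is the quotient of [cum f j.+1 - cum f j] by [M], the same for
    all copies, plus a carry of 0 or 1. *)
Lemma target_balanced f j (c c' : nat) : (target f j c <= (target f j c').+1)%N.
Proof.
have h (c0 : nat) : exists b : bool,
    target f j c0 = ((cum f j.+1 - cum f j) %/ M + b)%N.
  rewrite /target -{1}(subnKC (cum_mono f j)) addnAC divnD //.
  by eexists; rewrite -addnA addKn; reflexivity.
have [b ->] := h c; have [b' ->] := h c'.
by rewrite -addnS leq_add2l; case: b.
Qed.

Lemma row_upd G j y (s : {set 'I_M}) c : y \in U -> cls y = j ->
  (class_row (upd G y s) j c + (c \in G y) = class_row G j c + (c \in s))%N.
Proof.
move=> yU yj; rewrite /class_row (count_uniqD1 _ uU yU) [in RHS](count_uniqD1 _ uU yU).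
rewrite upd_eq yj eqxx /= [X in (_ + X + _)%N](_ : _ =
  count (fun z => (z != y) && ((cls z == j) && (c \in G z))) U).
  by rewrite addnAC [RHS]addnAC (addnC (c \in s)).
by apply: eq_count => z /=; case: eqVneq => //= zy; rewrite upd_neq.
Qed.

(** * Moving places between copies *)

Definition loads G g j : nat := (\sum_(y <- U | cls y == j) #|g y :\: G y|)%N.

Lemma loads_refl G j : loads G G j = 0%N.
Proof. by apply: big1 => y _; rewrite setDv cards0. Qed.

Lemma loads_upd G y (s : {set 'I_M}) j : (loads G (upd G y s) j <= #|s :\: G y|)%N.
Proof.
rewrite /loads big_mkcond /=; have [yU|yU] := boolP (y \in U).
  rewrite (bigD1_seq y) //= upd_eq big1 ?addn0; first by case: ifP.
  by move=> z zy; rewrite upd_neq // setDv cards0 if_same.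
rewrite big1_seq // => z /= zU; rewrite upd_neq ?setDv ?cards0 ?if_same //.
by apply: contraNneq yU => <-.
Qed.

Lemma loads_trans G1 G2 G3 j : (loads G1 G3 j <= loads G1 G2 j + loads G2 G3 j)%N.
Proof.
rewrite /loads -big_split /=; apply: leq_sum => y _.
apply: leq_trans (leq_card_setU _ _); apply: subset_leq_card.
apply/fintype.subsetP => c; rewrite !inE.
by case: (c \in G1 y); case: (c \in G2 y); case: (c \in G3 y).
Qed.

Lemma row_lt_page G j a b : (class_row G j b < class_row G j a)%N ->
  exists y, [/\ y \in U, cls y = j, a \in G y & b \notin G y].
Proof.
move=> lt; have [/hasP[y yU /and3P[/eqP yj ay bn]]|/hasPn h] :=
  boolP (has (fun y => [&& cls y == j, a \in G y & b \notin G y]) U).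
  by exists y.
suff : (class_row G j a <= class_row G j b)%N by lia.
rewrite /class_row (eq_in_count (a2 := fun y => (y \in U) && ((cls y == j) && (a \in G y)))).
  apply: sub_count => y /= /and3P[yU yj ay].
  by have := h y yU; rewrite yj ay /= negbK.
by move=> y ->.
Qed.

Lemma card_exchange (s : {set 'I_M}) a b : a \in s -> b \notin s ->
  #|b |: (s :\ a)| = #|s| /\ (#|(b |: (s :\ a)) :\: s| <= 1)%N.
Proof.
move=> sa nb; split.
  by rewrite cardsU1 !inE (negPf nb) andbF /= [in RHS](cardsD1 a s) sa.
rewrite -(cards1 b); apply: subset_leq_card; apply/fintype.subsetP => c.
by rewrite !inE => /andP[cs /orP[//|/andP[_ h]]]; rewrite h in cs.
Qed.

(** Balance of the new counts forces copy [a] to hold more pages of the class than [b], so some page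
    of [a] is absent from [b] and can be handed over with one load. *)
Lemma class_move G j (r' : 'I_M -> nat) a b :
  (forall c, (r' c + (c == a) = class_row G j c + (c == b))%N) ->
  (forall c c', r' c <= (r' c').+1)%N ->
  exists g, [/\ forall y, #|g y| = #|G y|, forall c, class_row g j c = r' c
              & (loads G g j <= 1)%N].
Proof.
move=> hr bal; have [ab|ab] := eqVneq a b.
  exists G; split=> // [c|]; last by rewrite loads_refl.
  by have := hr c; rewrite ab => /addIn.
have [y [yU yj ay bn]] : exists y, [/\ y \in U, cls y = j, a \in G y & b \notin G y].
  apply: row_lt_page; have := hr a; have := hr b; have := bal b a.
  rewrite !eqxx eq_sym (negPf ab); lia.
have [h1 h2] := card_exchange ay bn.
exists (upd G y (b |: (G y :\ a))); split.
- by move=> z; rewrite /upd; case: eqP => // ->.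
- move=> c; have := row_upd G (b |: (G y :\ a)) c yU yj; have := hr c.
  rewrite !inE; case: (eqVneq c a) => [->|ca] /=.
    by rewrite ay (negPf ab) /=; lia.
  case: (eqVneq c b) => [->|cb] /=; first by rewrite (negPf bn); lia.
  by case: (c \in G y) => /=; lia.
- exact: leq_trans (loads_upd _ _ _ _) h2.
Qed.

(** The new copy of [q] goes to any [b'] that lacks [q]; [class_move] then passes the surplus place
    from [b'] to [b]. *)
Lemma class_add G j (r' : 'I_M -> nat) q b :
  q \in U -> cls q = j -> (#|G q| < M)%N ->
  (forall c, r' c = class_row G j c + (c == b))%N ->
  (forall c c', r' c <= (r' c').+1)%N ->
  exists g, [/\ forall y, #|g y| = #|G y| + (y == q), forall c, class_row g j c = r' c
              & (loads G g j <= 2)%N]%N.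
Proof.
move=> qU qj qM hr bal.
have /subsetPn[b' _ b'n] : ~~ ([set: 'I_M] \subset G q).
  by apply/negP => /subset_leq_card; rewrite cardsT card_ord; lia.
pose g1 := upd G q (b' |: G q).
have c1 y : #|g1 y| = (#|G y| + (y == q))%N.
  rewrite /g1 /upd; case: eqP => [->|_]; last by rewrite addn0.
  by rewrite cardsU1 b'n addnC.
have l1 : (loads G g1 j <= 1)%N.
  apply: leq_trans (loads_upd _ _ _ _) _; rewrite -(cards1 b').
  apply: subset_leq_card; apply/fintype.subsetP => c; rewrite !inE.
  by case: (c == b') => //=; case: (c \in G q).
have r1 c : (class_row g1 j c = class_row G j c + (c == b'))%N.
  have := row_upd G (b' |: G q) c qU qj; rewrite -/g1 !inE.
  by case: (eqVneq c b') => [->|_] /=; rewrite ?(negPf b'n); lia.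
have [|g [h1 h2 h3]] := @class_move g1 j r' b' b _ bal.
  by move=> c; rewrite hr r1; lia.
exists g; split=> //; first by move=> y; rewrite h1.
have := loads_trans G g1 g j; lia.
Qed.

(** [q] leaves some copy [a'] without any load, and [a'] then receives the place that [a] has to
    give up. *)
Lemma class_del G j (r' : 'I_M -> nat) q a :
  q \in U -> cls q = j -> (0 < #|G q|)%N ->
  (forall c, r' c + (c == a) = class_row G j c)%N ->
  (forall c c', r' c <= (r' c').+1)%N ->
  exists g, [/\ forall y, #|g y| = #|G y| - (y == q), forall c, class_row g j c = r' c
              & (loads G g j <= 1)%N]%N.
Proof.
move=> qU qj qM hr bal.
have /card_gt0P[a' a'q] := qM.
pose g1 := upd G q (G q :\ a').
have c1 y : #|g1 y| = (#|G y| - (y == q))%N.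
  rewrite /g1 /upd; case: eqP => [->|_]; last by rewrite subn0.
  by rewrite (cardsD1 a' (G q)) a'q addKn.
have l1 : (loads G g1 j <= 0)%N.
  apply: leq_trans (loads_upd _ _ _ _) _.
  by rewrite leqn0 cards_eq0 setD_eq0 subD1set.
have r1 c : (class_row g1 j c + (c == a') = class_row G j c)%N.
  have := row_upd G (G q :\ a') c qU qj; rewrite -/g1 !inE.
  by case: (eqVneq c a') => [->|_] /=; rewrite ?a'q; lia.
have [|g [h1 h2 h3]] := @class_move g1 j r' a a' _ bal.
  by move=> c; rewrite hr -r1; lia.
exists g; split=> //; first by move=> y; rewrite h1.
have := loads_trans G g1 g j; lia.
Qed.

(** For: raising [F] by one changes the floor of [(F + c) / M] for exactly one copy [c]. *)
Lemma unique_carry (F : nat) : exists a, forall c, (M %| F + c.+1)%N = (c == a).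
Proof.
have h0 : (F %% M < M)%N by rewrite ltn_mod.
have h : (M.-1 - F %% M < M)%N by lia.
exists (Ordinal h) => c; rewrite -val_eqE /=.
rewrite {1}(divn_eq F M) -addnA dvdn_addr ?dvdn_mull //.
have cM := ltn_ord c; apply/idP/eqP => [/dvdnP[[|[|m]] e]|->]; try lia.
by have -> : (F %% M + (M.-1 - F %% M).+1 = M)%N by lia.
Qed.

Lemma carry (F : nat) c : ((F.+1 + c) %/ M = (F + c) %/ M + (M %| F + c.+1))%N.
Proof. by rewrite addSn addnS divnS // addnC. Qed.

Lemma cum_succ f f' q j : q \in U -> f' q = (f q).+1 ->
  (forall y, y != q -> f' y = f y) -> cum f' j = (cum f j + (cls q < j))%N.
Proof.
move=> qU fq ff; rewrite /cum big_mkcond [in RHS]big_mkcond /=.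
rewrite (bigD1_seq q) //= [in RHS](bigD1_seq q) //= fq.
rewrite [X in (_ + X)%N = _](eq_bigr (fun y => if (cls y < j)%N then f y else 0%N)).
  by case: (cls q < j)%N; lia.
by move=> y yq; rewrite ff.
Qed.

(* A lighter class only sees both ends of its window shift, hence trades one
   place between two copies. *)
Lemma target_succ f f' q j : q \in U -> f' q = (f q).+1 ->
  (forall y, y != q -> f' y = f y) ->
  exists a b, forall c,
    (target f' j c + (cls q < j) * (c == a) =
     target f j c + (cls q <= j) * (c == b))%N.
Proof.
move=> qU fq ff.
have [a ha] := unique_carry (cum f j); have [b hb] := unique_carry (cum f j.+1).
exists a, b => c; have := targetE f j c; have := targetE f' j c.
rewrite !(cum_succ _ qU fq ff) -ha -hb ltnS.
have := carry (cum f j) c; have := carry (cum f j.+1) c.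
case: (leqP (cls q) j) => h1; case: (ltnP (cls q) j) => h2;
  rewrite ?addn0 ?addn1 ?mul1n ?mul0n;
  move: (target f' j c) (target f j c) (((cum f j).+1 + c) %/ M)%N ((cum f j + c) %/ M)%N
    (((cum f j.+1).+1 + c) %/ M)%N ((cum f j.+1 + c) %/ M)%N
    (M %| cum f j + c.+1)%N (M %| cum f j.+1 + c.+1)%N => ? ? ? ? ? ? [] []; lia.
Qed.

Lemma assemble f' G (B : nat -> nat) :
  (forall j, exists g, [/\ forall y, y \in U -> cls y = j -> #|g y| = f' y,
     forall c, class_row g j c = target f' j c & (loads G g j <= B j)%N]) ->
  exists g, consistent f' g /\ forall j, (loads G g j <= B j)%N.
Proof.
move=> /choice[gs hgs]; exists (fun y => gs (cls y) y); split; first split.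
- by move=> y yU; have [h _ _] := hgs (cls y); exact: h.
- move=> j c; have [_ <- _] := hgs j; apply: eq_count => y /=.
  by case: eqP => // ->.
- move=> j; have [_ _ h] := hgs j; apply: leq_trans h.
  by rewrite /loads leq_eqVlt; apply/orP; left; apply/eqP; apply: eq_bigr => y /eqP ->.
Qed.

(** * The cost of rebalancing *)

Definition move_cost G g : R :=
  \sum_(y <- U) W (cls y) * #|g y :\: G y|%:R.

Lemma move_costE G g : move_cost G g = \sum_(j < n) W j * (loads G g j)%:R.
Proof.
rewrite /move_cost /loads.
under [RHS]eq_bigr do rewrite natr_sum mulr_sumr big_mkcond /=.
rewrite exchange_big /=; apply: eq_bigr => y _.
rewrite (bigD1 (Ordinal (cls_lt y))) //= eqxx big1 ?addr0 // => j jy.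
by rewrite ifF //; apply: contraNF jy => /eqP jy; apply/eqP/val_inj.
Qed.

(** Halving leaves a reserve as large as the last term; carrying this reserve on the left closes the
    induction. *)
Lemma geom_tail i m :
  \sum_(j < m) (if (i < j)%N then W j else 0) +
    (if (i < m)%N then W m.-1 else W i) <= W i.
Proof.
elim: m => [|m IH]; first by rewrite big_ord0 add0r.
rewrite big_ord_recr /=; have [im|im] := ltnP i m.
  rewrite (leqW im); rewrite im in IH; have := W_geom m.-1.
  by rewrite prednK ?mulr2n; [lra|lia].
rewrite addr0; rewrite ltnNge im /= in IH.
case: (ltnP i m.+1) => // h; rewrite (_ : W m = W i) //.
by congr W; lia.
Qed.

Lemma move_cost_le i G g :
  (forall j, loads G g j <= if j == i then 2 else (i < j)%N)%N ->
  move_cost G g <= 3 * W i.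
Proof.
move=> h; rewrite move_costE.
apply: (@le_trans _ _ (\sum_(j < n) ((if (i < j)%N then W j else 0) +
     (if (j == i :> nat) then 2 * W i else 0)))).
  apply: ler_sum => j _; have := h j; have := W_ge0 j.
  have [->|ji] := eqVneq (j : nat) i.
    rewrite ltnn add0r => w0 hl; rewrite mulrC ler_wpM2r // ler_nat //.
  case: (i < j)%N => w0 hl; rewrite addr0.
    by rewrite -[X in _ <= X]mulr1 ler_wpM2l // -[1]/(1%:R) ler_nat.
  by move: hl; rewrite leqn0 => /eqP ->; rewrite mulr0.
rewrite big_split /=.
have -> : \sum_(j < n) (if (j == i :> nat) then 2 * W i else 0) =
    (if (i < n)%N then 2 * W i else 0).
  case: ltnP => hi.
    rewrite (bigD1 (Ordinal hi)) //= eqxx big1 ?addr0 // => j ji.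
    by rewrite ifF //; apply: contraNF ji => /eqP ji; apply/eqP/val_inj.
  by rewrite big1 // => j _; rewrite ifF //; apply/negbTE; have := ltn_ord j; lia.
have := geom_tail i n; have := W_ge0 i; have := W_ge0 n.-1.
by case: ifP => _ w1 w2; lra.
Qed.

(** Heavier classes keep their targets, the class of [q] needs at most two loads, and the lighter
    classes one each, which together cost at most [W (cls q)]. *)
Lemma round_succ f f' q G : q \in U -> f' q = (f q).+1 ->
  (forall y, y != q -> f' y = f y) -> (f q < M)%N -> consistent f G ->
  exists2 g, consistent f' g & move_cost G g <= 3 * W (cls q).
Proof.
move=> qU fq ff qM [cG rG].
suff [g [cg lg]] : exists g, consistent f' g /\
    forall j, (loads G g j <= if j == cls q then 2 else (cls q < j)%N)%N.
  by exists g => //; exact: move_cost_le.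
apply: (assemble (B := fun j => (if j == cls q then 2 else cls q < j)%N)) => j.
have [a [b hab]] := target_succ j qU fq ff.
have bal c c' : (target f' j c <= (target f' j c').+1)%N by exact: target_balanced.
have [jq|jq] := eqVneq j (cls q).
  have [|||g [h1 h2 h3]] := @class_add G j (target f' j) q b qU _ _ _ bal => //.
  - by rewrite cG.
  - by move=> c; have := hab c; rewrite rG jq ltnn leqnn mul0n mul1n addn0.
  exists g; split=> // y yU yj; rewrite h1 cG //.
  by have [->|yq] := eqVneq y q; [rewrite fq addn1|rewrite ff // addn0].
have ff' y : cls y = j -> f' y = f y.
  by move=> yj; apply: ff; apply: contraNneq jq => <-; rewrite yj.
have [qj|qj] := ltnP (cls q) j.
  have [|g [h1 h2 h3]] := @class_move G j (target f' j) a b _ bal.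
    by move=> c; have := hab c; rewrite rG qj (ltnW qj) !mul1n.
  by exists g; split=> // y yU yj; rewrite h1 cG // ff'.
exists G; split=> [y yU yj|c|]; rewrite ?loads_refl ?cG ?ff' //.
have := hab c; rewrite rG ltnNge qj /= leqNgt ltn_neqAle jq qj /=.
by rewrite !mul0n !addn0.
Qed.

Lemma round_pred f f' q G : q \in U -> f q = (f' q).+1 ->
  (forall y, y != q -> f' y = f y) -> consistent f G ->
  exists2 g, consistent f' g & move_cost G g <= 3 * W (cls q).
Proof.
move=> qU fq ff0 [cG rG]; have ff y : y != q -> f y = f' y by move/ff0.
suff [g [cg lg]] : exists g, consistent f' g /\
    forall j, (loads G g j <= if j == cls q then 2 else (cls q < j)%N)%N.
  by exists g => //; exact: move_cost_le.
apply: (assemble (B := fun j => (if j == cls q then 2 else cls q < j)%N)) => j.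
(* Read backwards the change is an increase by one, so [a] and [b] trade roles. *)
have [a [b hab]] := target_succ j qU fq ff.
have bal c c' : (target f' j c <= (target f' j c').+1)%N by exact: target_balanced.
have [jq|jq] := eqVneq j (cls q).
  have [|||g [h1 h2 h3]] := @class_del G j (target f' j) q b qU _ _ _ bal => //.
  - by rewrite cG // fq.
  - by move=> c; have := hab c; rewrite rG jq ltnn leqnn mul0n mul1n addn0.
  exists g; split=> // [y yU yj|]; last exact: leq_trans h3 _.
  rewrite h1 cG //.
  by have [->|yq] := eqVneq y q; [rewrite fq subn1|rewrite ff // subn0].
have ff' y : cls y = j -> f' y = f y.
  by move=> yj; rewrite ff //; apply: contraNneq jq => <-; rewrite yj.
have [qj|qj] := ltnP (cls q) j.
  have [|g [h1 h2 h3]] := @class_move G j (target f' j) b a _ bal.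
    by move=> c; have := hab c; rewrite rG qj (ltnW qj) !mul1n.
  by exists g; split=> // y yU yj; rewrite h1 cG // ff'.
exists G; split=> [y yU yj|c|]; rewrite ?loads_refl ?cG ?ff' //.
have := hab c; rewrite rG ltnNge qj /= leqNgt ltn_neqAle jq qj /=.
by rewrite !mul0n !addn0.
Qed.

Lemma move_cost_refl G : move_cost G G = 0.
Proof. by apply: big1 => y _; rewrite setDv cards0 mulr0. Qed.

Lemma move_cost_trans G1 G2 G3 :
  move_cost G1 G3 <= move_cost G1 G2 + move_cost G2 G3.
Proof.
rewrite !move_costE -big_split /=; apply: ler_sum => j _.
by rewrite -mulrDr -natrD ler_wpM2l // ler_nat loads_trans.
Qed.

Definition dist f f' : R :=
  \sum_(y <- U) W (cls y) * ((f y - f' y) + (f' y - f y))%N%:R.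

Lemma round_exists f f' G :
  (forall y, y \in U -> f' y <= M)%N -> consistent f G ->
  exists2 g, consistent f' g & move_cost G g <= 3 * dist f f'.
Proof.
move=> f'M; have [m] := ubnP (\sum_(y <- U) ((f y - f' y) + (f' y - f y)))%N.
elim: m f G => // m IH f G hm cG.
have [/hasP[q qU fq]|/hasPn h] := boolP (has (fun y => f y != f' y) U); last first.
  exists G; last first.
    rewrite move_cost_refl mulr_ge0 // sumr_ge0 // => y _.
    by rewrite mulr_ge0 // ler0n.
  have e y : y \in U -> f y = f' y by move=> yU; apply/eqP; have := h y yU; rewrite negbK.
  have ec j : cum f' j = cum f j.
    by rewrite /cum big_seq_cond [in RHS]big_seq_cond; apply: eq_bigr => y /andP[yU _]; rewrite e.
  split=> [y yU|j c]; first by rewrite cG.1 // e.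
  by rewrite cG.2 /target !ec.
pose f1 := upd f q (if (f q < f' q)%N then (f q).+1 else (f q).-1).
have f1q y : y != q -> f1 y = f y by move=> yq; rewrite /f1 upd_neq.
have [g1 cg1 mg1] : exists2 g, consistent f1 g & move_cost G g <= 3 * W (cls q).
  case: (ltnP (f q) (f' q)) (erefl f1) => h e.
    apply: (@round_succ f f1 q) => //; first by rewrite /f1 upd_eq h.
    by have := f'M q qU; lia.
  apply: (@round_pred f f1 q) => //; rewrite /f1 upd_eq ltnNge h /=; lia.
have dq : (((f q - f' q) + (f' q - f q)) =
           ((f1 q - f' q) + (f' q - f1 q)).+1)%N.
  by rewrite /f1 upd_eq; case: ifP; lia.
have [|g cg mg] := IH f1 g1 _ cg1.
  have e : (\sum_(y <- U | y != q) ((f1 y - f' y) + (f' y - f1 y)) =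
            \sum_(y <- U | y != q) ((f y - f' y) + (f' y - f y)))%N.
    by apply: eq_bigr => y yq; rewrite f1q.
  by rewrite (bigD1_seq q) //= dq in hm; rewrite (bigD1_seq q) //= e.
exists g => //; apply: le_trans (move_cost_trans G g1 g) _.
suff -> : dist f f' = W (cls q) + dist f1 f' by lra.
rewrite /dist (bigD1_seq q) //= [in RHS](bigD1_seq q) //= dq addrA.
congr (_ + _); first by rewrite -natr1; ring.
by apply: eq_bigr => y yq; rewrite f1q.
Qed.

End Rounding.

(** * Following an offline schedule *)

Lemma upd_count (P : eqType) (U : seq P) (K Q : pred P) (y : P) (b : bool) :
  uniq U -> y \in U ->
  (count (fun z => upd K y b z && Q z) U + (K y && Q y) =
   count (fun z => K z && Q z) U + (b && Q y))%N.
Proof.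
move=> uU yU; rewrite (count_uniqD1 _ uU yU) [in RHS](count_uniqD1 _ uU yU).
rewrite upd_eq (@eq_count _ _ (fun z => (z != y) && (K z && Q z))).
  by rewrite addnAC [RHS]addnAC (addnC (b && Q y)).
by move=> z /=; case: eqVneq => //= zy; rewrite upd_neq.
Qed.

Lemma upd_count1 (P : eqType) (U : seq P) (K : pred P) (y : P) (b : bool) :
  uniq U -> y \in U -> (count (upd K y b) U + K y = count K U + b)%N.
Proof.
move=> uU yU; have := upd_count K predT b uU yU; rewrite !andbT.
by rewrite !(eq_count (fun z => andbT _)).
Qed.

(** * Keeping the comparator ahead of the offline cache *)

Section Dominance.
Variables (P : choiceType) (cls : P -> nat) (U : seq P).
Hypothesis uU : uniq U.

Definition near (idx : P -> nat) (j m : nat) : pred P :=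
  fun y => (cls y == j) && (idx y < m)%N.

(** The first clause says that, in each class, the [i]-th nearest page of [K] exists and is
    requested no later than the [i]-th nearest page of [O]. *)
Definition dominates (idx : P -> nat) (K O : pred P) : Prop :=
  (forall j m, count (fun y => O y && near idx j m y) U <=
               count (fun y => K y && near idx j m y) U)%N /\
  (count K U <= count O U)%N.

Lemma dominates_class idx K O j : dominates idx K O ->
  (count (fun y => O y && (cls y == j)) U <=
   count (fun y => K y && (cls y == j)) U)%N.
Proof.
(* A threshold above all indices turns the initial segment into the whole class. *)
move=> [h _]; have := h j (\sum_(y <- U) idx y).+1.
have e (X : pred P) : count (fun y => X y && near idx j (\sum_(y <- U) idx y).+1 y) U
   = count (fun y => X y && (cls y == j)) U.
  apply: eq_in_count => y yU /=; rewrite /near ltnS (big_rem y) //= leq_addr.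
  by rewrite andbT.
by rewrite !e.
Qed.

(** The comparator drops its farthest page [z] of the class. A segment containing [z] contains all
    its pages of the class, so there [dominates_class] suffices. *)
Lemma dominates_evict idx K O y : dominates idx K O -> y \in U -> O y ->
  exists z, [/\ K z, cls z = cls y & dominates idx (upd K z false) (upd O y false)].
Proof.
move=> dKO yU Oy; have [dom tot] := dKO.
have domc := dominates_class (cls y) dKO.
pose s := [seq z <- U | K z && (cls z == cls y)].
have [x0 x0s] : exists x0, x0 \in s.
  have : (0 < size s)%N.
    rewrite size_filter; apply: leq_trans domc.
    by rewrite -has_count; apply/hasP; exists y; rewrite ?Oy ?eqxx.
  by case: (s) => // x s' _; exists x; exact: mem_head.
have [z zs zmax] := seq_argmin (fun z => idx z : nat^d) x0s.
move: zs; rewrite mem_filter => /andP[/andP[Kz /eqP zy] zU].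
exists z; split=> //; split; last first.
  have := upd_count1 K false uU zU; have := upd_count1 O false uU yU.
  by rewrite Kz Oy /= !addn0 !addn1 => e1 e2; lia.
move=> j m; have := upd_count K (near idx j m) false uU zU.
have := upd_count O (near idx j m) false uU yU.
rewrite Kz Oy /= !addn0; have := dom j m.
have [jy|jy] := eqVneq (cls y) j; last first.
  have nf v : cls v = cls y -> near idx j m v = false.
    by rewrite /near => ->; rewrite (negPf jy).
  by rewrite !nf // !addn0 => h -> ->.
case: (boolP (near idx j m z)) => hz; last first.
  rewrite addn0 => h h1 ->; apply: leq_trans h; rewrite -h1; exact: leq_addr.
have e : count (fun x => K x && near idx j m x) U =
         count (fun x => K x && (cls x == cls y)) U.
  apply: eq_in_count => x xU /=; rewrite /near jy.
  case: (boolP (K x)) => Kx //=; case: (boolP (cls x == j)) => xj //=.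
  have : x \in s by rewrite mem_filter Kx jy xj.
  move/zmax => hx; move: hz => /andP[_]; apply: leq_ltn_trans; exact: hx.
have := upd_count O (fun x => cls x == cls y) false uU yU; rewrite Oy eqxx /=.
have : (count (fun x => upd O y false x && near idx j m x) U <=
        count (fun x => upd O y false x && (cls x == cls y)) U)%N.
  by apply: sub_count => x /= /andP[-> /andP[+ _]]; rewrite jy.
rewrite e addn0 !addn1 => h1 h2 _ _ h3.
by rewrite -ltnS h3; apply: leq_trans domc; rewrite -h2 ltnS.
Qed.

(** The comparator loads the nearest page [x] of the class that the new offline cache has and it
    lacks. In segments ending before [x] it already has all those pages; longer segments gain [x],
    which makes up for [y]. *)
Lemma dominates_load idx (K O : pred P) y : dominates idx K O -> y \in U -> ~~ O y ->
  dominates idx K (upd O y true) \/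
  exists2 x, ~~ K x & dominates idx (upd K x true) (upd O y true).
Proof.
move=> [dom tot] yU nO.
have tot' := upd_count1 O true uU yU; rewrite (negPf nO) /= addn0 addn1 in tot'.
have other j m : cls y != j ->
    count (fun z => upd O y true z && near idx j m z) U =
    count (fun z => O z && near idx j m z) U.
  move=> yj; have := upd_count O (near idx j m) true uU yU.
  by rewrite /near (negPf yj) (negPf nO) /= !addn0.
pose s := [seq x <- U | [&& cls x == cls y, upd O y true x & ~~ K x]].
have [s0|[x0 x0s]] : (s = [::]) \/ exists x0, x0 \in s.
  by case: (s) => [|x s']; [left|right; exists x; exact: mem_head].
  left; split; last by rewrite tot'; exact: leqW.
  move=> j m; have [yj|yj] := eqVneq (cls y) j; last by rewrite other.
  rewrite (@eq_in_count _ _ (fun z => (z \in U) && (upd O y true z && near idx j m z)));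
    last by move=> z ->.
  apply: sub_count => z /= /and3P[zU Oz nz]; rewrite nz andbT.
  apply/negPn/negP => nK; have : z \in s.
    by rewrite mem_filter zU Oz nK !andbT yj; case/andP: nz.
  by rewrite s0.
right; have [x xs xmin] := seq_argmin idx x0s.
move: xs; rewrite mem_filter => /andP[/and3P[/eqP xy Ox nK] xU].
exists x => //; have totx := upd_count1 K true uU xU; rewrite (negPf nK) /= addn0 addn1 in totx.
split; last by rewrite totx tot' ltnS.
move=> j m; have := upd_count K (near idx j m) true uU xU; rewrite (negPf nK) /= addn0 => ->.
have [yj|yj] := eqVneq (cls y) j; last first.
  by rewrite other // [near idx j m x]/near xy (negPf yj) /= addn0.
have := upd_count O (near idx j m) true uU yU; rewrite (negPf nO) /= addn0 => eO.
have [xm|mx] := ltnP (idx x) m.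
  rewrite eO [near idx j m x]/near xy yj eqxx xm /=; have := dom j m.
  by case: (near idx j m y) => /=; lia.
apply: leq_trans (leq_addr _ _).
rewrite (@eq_in_count _ _ (fun z => (z \in U) && (upd O y true z && near idx j m z)));
    last by move=> z ->.
apply: sub_count => z /= /and3P[zU Oz nz]; rewrite nz andbT.
apply/negPn/negP => nKz; have /xmin : z \in s.
  by rewrite mem_filter zU Oz nKz !andbT yj; case/andP: nz.
move: nz => /andP[_]; rewrite leEnat; lia.
Qed.

(** [q] alone has index 0, so the segment with bound 1 forces it into [K]. Then the other indices
    drop by one, while [q], held by both caches, affects both counts equally. *)
Lemma dominates_request (idx idx' : P -> nat) q (K O : pred P) :
  q \in U -> idx q = 0%N -> (forall y, y != q -> idx y = (idx' y).+1) ->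
  dominates idx K O -> O q -> K q /\ dominates idx' K O.
Proof.
move=> qU q0 hidx [dom tot] Oq.
have Kq : K q.
  have : (0 < count (fun y => K y && near idx (cls q) 1 y) U)%N.
    apply: leq_trans (dom (cls q) 1%N); rewrite -has_count; apply/hasP.
    by exists q => //; rewrite Oq /near q0 eqxx.
  rewrite -has_count => /hasP[y yU /and3P[Ky _]].
  by have [<-//|yq] := eqVneq y q; rewrite hidx.
split=> //; split=> // j m.
have h (X : pred P) : X q ->
   (count (fun y => X y && near idx' j m y) U + (cls q == j) =
    count (fun y => X y && near idx j m.+1 y) U + near idx' j m q)%N.
  move=> Xq; rewrite (count_uniqD1 _ uU qU) [in RHS](count_uniqD1 _ uU qU) Xq /=.
  rewrite [near idx j m.+1 q]/near q0 andbT.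
  rewrite (@eq_count _ _ (fun z => (z != q) && (X z && near idx j m.+1 z))).
    by rewrite addnAC [RHS]addnAC (addnC (near _ _ _ _)).
  by move=> z /=; case: eqVneq => //= zq; rewrite /near hidx.
have := h K Kq; have := h O Oq; have := dom j m.+1; lia.
Qed.

Lemma dominates_better (e : rel P) idx q S K K' O : compat e idx ->
  {subset S <= U} -> better cls e q S K K' -> dominates idx K O -> dominates idx K' O.
Proof.
move=> ce SU [_ /(_ U uU SU)[eK hK]] [dom tot]; split; last by rewrite eK.
move=> j m; apply: leq_trans (dom j m) _; apply: hK => y y' cyy'.
rewrite ce -leqNgt /near cyy' => h /andP[-> h2] /=.
exact: leq_ltn_trans h h2.
Qed.

End Dominance.

Section OptMove.
Variables (R : realFieldType) (P : choiceType) (n : nat) (W : nat -> R).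
Variables (cls : P -> nat) (l : nat).
Hypothesis W_ge0 : forall j, 0 <= W j.
Hypothesis cls_lt : forall p, (cls p < n)%N.
Variable U : seq P.
Hypothesis uU : uniq U.

(** [O] is turned into [O'] page by page. By [Phi_delta] an eviction costs at most [l.+1] times its
    weight, and a load in the comparator never raises [Phi]. *)
Lemma opt_move idx (st : fstate R P) (K O O' : pred P) : wf W cls l st ->
  dominates cls U idx K O ->
  exists2 K', dominates cls U idx K' O' &
    Phi n W cls l st K' <= Phi n W cls l st K +
      l.+1%:R * \sum_(y <- U) (if O y && ~~ O' y then W (cls y) else 0).
Proof.
move=> wfs; have [m] := ubnP (count (fun y => O y != O' y) U).
elim: m K O => // m IH K O hm dKO.
have [/hasP[y yU Oy]|/hasPn h] := boolP (has (fun y => O y != O' y) U); last first.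
  have e (Q : pred P) : count (fun y => O' y && Q y) U = count (fun y => O y && Q y) U.
    by apply: eq_in_count => y yU; have := h y yU; rewrite negbK => /eqP ->.
  exists K; last first.
    rewrite lerDl mulr_ge0 // sumr_ge0 // => y _; by case: ifP.
  split=> [j i|]; first by rewrite e; exact: dKO.1.
  have := e predT; rewrite !(eq_count (fun z => andbT _)) => ->; exact: dKO.2.
have less b : b = O' y -> (count (fun z => upd O y b z != O' z) U < m)%N.
  move=> bO; rewrite (count_uniqD1 _ uU yU) /= Oy add1n in hm.
  rewrite (count_uniqD1 _ uU yU) /= upd_eq bO eqxx /= add0n.
  rewrite (@eq_count _ _ (fun z => (z != y) && (O z != O' z))) //.
  by move=> z /=; case: eqVneq => //= zy; rewrite upd_neq.
have [Oyt|Oyf] := boolP (O y).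
  have O'y : O' y = false by move: Oy; rewrite Oyt; case: (O' y).
  have [z [Kz zy d1]] := dominates_evict uU dKO yU Oyt.
  have [K' d' ph] := IH _ _ (less false (esym O'y)) d1.
  exists K' => //; apply: le_trans ph _.
  have nK1 : ~~ upd K z false z by rewrite upd_eq.
  have := @Phi_delta _ _ n W cls l W_ge0 cls_lt st (upd K z false) K z wfs nK1 Kz.
  case/(_ _)/andP => [x xz|_ h]; first by rewrite upd_neq.
  apply: le_trans (lerD h (lexx _)) _; rewrite -addrA lerD2l zy mulrC -mulrDr.
  rewrite ler_wpM2l //.
  rewrite (bigD1_seq y) //= [in X in _ <= X](bigD1_seq y) //= upd_eq Oyt O'y /= add0r.
  rewrite lerD2l; apply: ler_sum => x xy; by rewrite upd_neq.
have O'y : O' y by move: Oy; rewrite (negPf Oyf); case: (O' y).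
have same : \sum_(z <- U) (if upd O y true z && ~~ O' z then W (cls z) else 0) =
            \sum_(z <- U) (if O z && ~~ O' z then W (cls z) else 0).
  apply: eq_bigr => z _; rewrite /upd; case: eqP => // ->.
  by rewrite O'y !andbF.
have [d1|[x nKx d1]] := dominates_load uU dKO yU Oyf.
  have [K' d' ph] := IH _ _ (less true (esym O'y)) d1.
  by exists K' => //; rewrite -same.
have [K' d' ph] := IH _ _ (less true (esym O'y)) d1.
exists K' => //; rewrite -same; apply: le_trans ph _; rewrite lerD2r.
have Kx : upd K x true x by rewrite upd_eq.
have := @Phi_delta _ _ n W cls l W_ge0 cls_lt st K (upd K x true) x wfs nKx Kx.
by case/(_ _)/andP => // z zx; rewrite upd_neq.
Qed.

End OptMove.

(** * The algorithm *)

Definition page_index (P : eqType) (sigma : seq P) (t : nat) (y : P) : nat :=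
  index y (drop t sigma).

Lemma sched_costE (R : realType) (P : choiceType) (w : P -> R) C0 cs :
  sched_cost w C0 cs = \sum_(t < size cs)
    \sum_(p <- undup (nth [::] cs t) | p \notin nth [::] (C0 :: cs) t) w p.
Proof.
elim: cs C0 => [|C cs IH] C0 /=; first by rewrite big_ord0.
by rewrite big_ord_recl /= IH.
Qed.

Lemma view_map (P : choiceType) (x0 : P) (sigma : seq P) (t : nat) :
  (t < size sigma)%N ->
  view sigma t = [seq (nth x0 sigma s, earlier sigma s) | s <- iota 0 t.+1].
Proof.
move=> ts; rewrite /view -(map_nth_iota0 x0 ts).
rewrite -[X in zip _ X]map_id zip_map -map_comp.
by apply: eq_map.
Qed.

Section Algorithm.
Variables (R : realType) (P : choiceType) (n : nat) (W : nat -> R).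
Variables (cls : P -> nat) (k l : nat).
Hypothesis k_gt0 : (0 < k)%N.
Hypothesis W_ge0 : forall j, 0 <= W j.
Hypothesis W_geom : forall j, W j.+1 *+ 2 <= W j.
Hypothesis cls_lt : forall p, (cls p < n)%N.
Hypothesis n_le : (n <= 2 ^ l)%N.

Let M_gt0 : (0 < 2 ^ l)%N. Proof. by rewrite expn_gt0. Qed.

Record astate := AState { frac : fstate R P; holders : P -> {set 'I_(2 ^ l)} }.

Definition amount (st : fstate R P) (y : P) : nat := copies l (lev st y).

Definition content (st : fstate R P) : R :=
  \sum_(y <- pages st) W (cls y) * (amount st y)%:R.

Record good (s : astate) : Prop := Good {
  good_wf : wf W cls l (frac s);
  good_mass : (mass l (frac s) <= k * 2 ^ l)%N;
  good_consistent :
    consistent cls (pages (frac s)) (amount (frac s)) (holders s);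
  good_out : forall y, y \notin pages (frac s) -> holders s y = finset.set0 }.

Definition step_rel (x : P * (P -> P -> bool)) (s s' : astate) : Prop :=
  [/\ good s', evict n W cls k l x.2 x.1 (request x.1 (frac s)) (frac s')
    & move_cost W cls (pages (frac s')) (holders s) (holders s') <=
      3 * dist W cls (pages (frac s')) (amount (frac s)) (amount (frac s'))].

Lemma amount_out st y : wf W cls l st -> y \notin pages st -> amount st y = 0%N.
Proof. by move=> wfs yn; rewrite /amount (wf_out wfs yn) copies_top. Qed.

Lemma consistent_request s q : good s ->
  consistent cls (pages (request q (frac s))) (amount (frac s)) (holders s).
Proof.
case=> wfs _ cs out; rewrite /=; case: ifP => // qn.
have am0 : amount (frac s) q = 0%N by apply: amount_out; rewrite ?qn.
have h0 : holders s q = finset.set0 by apply: out; rewrite qn.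
case: cs => c r; split.
  by move=> y; rewrite inE => /orP[/eqP ->|/c //]; rewrite am0 h0 cards0.
move=> j c0; have := r j c0; rewrite /class_row /= h0 inE andbF add0n => ->.
rewrite /target /cum !big_cons am0.
by do 2 case: ifP.
Qed.

Lemma step_exists q e idx s : compat e idx -> good s ->
  exists s', step_rel (q, e) s s'.
Proof.
move=> ce gs; have wfs := good_wf gs.
have wf1 := request_wf W_ge0 q wfs.
have qin : q \in pages (request q (frac s)) by rewrite request_pages eqxx.
have q0 : lev (request q (frac s)) q = 0%N by rewrite /= upd_eq.
have [st' ev small] := evict_exists W_ge0 cls_lt n_le ce k_gt0 wf1 qin q0.
have [wf' p' _ _ _] := ev.
have [||g cg mg] := round_exists W_ge0 W_geom cls_lt M_gt0 (wf_uniq wf')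
   (f := amount (frac s)) (f' := amount st') (G := holders s).
- by move=> y _; exact: copies_le.
- by rewrite p'; exact: consistent_request.
exists (AState st' (fun y => if y \in pages st' then g y else finset.set0)).
have gE (y : P) : y \in pages st' -> (if y \in pages st' then g y else finset.set0) = g y.
  by move=> ->.
split=> //=.
- split=> //=; last by move=> y /negPf ->.
  split=> [y yin|j c]; first by rewrite gE // cg.1.
  by rewrite -cg.2; apply: eq_in_count => y /= ->.
- apply: le_trans mg; rewrite /move_cost.
  by rewrite big_seq [in X in _ <= X]big_seq; apply: ler_sum => y yin; rewrite gE.
Qed.

(** [x] carries only the requested page and the order of next requests, so this choice is myopic.
    The default [s] is never met along a request sequence. *)
Definition step (s : astate) (x : P * (P -> P -> bool)) : astate :=
  if pselect (exists s', step_rel x s s') is left h then projT1 (cid h) else s.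

Definition start : astate :=
  AState (FState [::] (fun=> l.+1) (fun=> 0) (fun _ _ => 0)) (fun=> finset.set0).

Lemma start_good : good start.
Proof.
have wf0 : wf W cls l (frac start).
  by split=> //= [y|j i]; rewrite lexx W_ge0.
split=> //; first by rewrite /mass big_nil.
split=> // j c; rewrite /class_row /target /cum /= !big_nil.
by rewrite subnn.
Qed.

(** All copies replay the same run on the view and differ only in the pages they read off
    [holders]. *)
Definition alg (c : 'I_(2 ^ l)) : myopic_alg P := fun v =>
  let s := foldl step start v in [seq y <- pages (frac s) | c \in holders s y].

Section Run.
Variable sigma : seq P.
Variable x0 : P.

Definition state (t : nat) : astate :=
  foldl step start [seq (nth x0 sigma s, earlier sigma s) | s <- iota 0 t].

Lemma state_step t : good (state t) ->
  step_rel (nth x0 sigma t, earlier sigma t) (state t) (state t.+1).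
Proof.
move=> gs; have -> : state t.+1 = step (state t) (nth x0 sigma t, earlier sigma t).
  by rewrite /state -addn1 iotaD map_cat foldl_cat.
rewrite /step; case: pselect => [h|[]]; first by case: (cid h).
by apply: (@step_exists _ _ (page_index sigma t.+1)).
Qed.

Lemma state_good t : good (state t).
Proof.
by elim: t => [|t IH]; [exact: start_good|have [] := state_step IH].
Qed.

Definition cache (c : 'I_(2 ^ l)) (t : nat) : seq P :=
  [seq y <- pages (frac (state t)) | c \in holders (state t) y].

Lemma nth_run c t : (t < size sigma)%N ->
  nth [::] (run (alg c) sigma) t = cache c t.+1.
Proof.
move=> ts; rewrite /run (nth_map 0%N) ?size_iota // nth_iota // add0n.
by rewrite /alg (view_map x0 ts).
Qed.

Lemma pages_step t : pages (frac (state t.+1)) =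
  pages (request (nth x0 sigma t) (frac (state t))).
Proof. by have [_ [_ -> _ _ _] _] := state_step (state_good t). Qed.

Lemma uniq_cache c t : uniq (cache c t).
Proof. by rewrite filter_uniq // (wf_uniq (good_wf (state_good t))). Qed.

Lemma mem_cache c t y : (y \in cache c t) = (c \in holders (state t) y).
Proof.
rewrite mem_filter; case: (boolP (y \in pages _)) => h; rewrite ?andbT ?andbF //.
by rewrite (good_out (state_good t) h) inE.
Qed.

(** The targets of copy [c] telescope to at most the floor of [(F + c) / 2 ^ l], where
    [F <= k * 2 ^ l] and [c < 2 ^ l]. *)
Lemma size_cache c t : (size (cache c t) <= k)%N.
Proof.
have gs := state_good t; have [_ rows] := good_consistent gs.
rewrite size_filter -(sum_count_classes (fun y => c \in holders (state t) y)
   (pages (frac (state t))) cls_lt).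
rewrite (eq_bigr (fun j : 'I_n => target cls (2 ^ l) (pages (frac (state t)))
   (amount (frac (state t))) j c)); last first.
  by move=> j _; rewrite -rows.
set U := pages _; set f := amount _.
have e m : (\sum_(j < m) target cls (2 ^ l) U f j c + (cum cls U f 0 + c) %/ 2 ^ l =
    (cum cls U f m + c) %/ 2 ^ l)%N.
  elim: m => [|m IH]; first by rewrite big_ord0.
  by rewrite big_ord_recr /= -targetE // -IH addnAC addnC.
apply: leq_trans (leq_addr ((cum cls U f 0 + c) %/ 2 ^ l) _) _; rewrite e.
have : (cum cls U f n <= k * 2 ^ l)%N.
  by rewrite /cum; under eq_bigl do rewrite cls_lt; exact: good_mass gs.
have := ltn_ord c => c1 c2; rewrite -ltnS ltn_divLR //; lia.
Qed.

Lemma requested_cached c t : nth x0 sigma t \in cache c t.+1.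
Proof.
rewrite mem_cache; have [gs [_ pg q0 _ _] _] := state_step (state_good t).
have [cards _] := good_consistent gs.
have qin : nth x0 sigma t \in pages (frac (state t.+1)).
  by rewrite pages_step request_pages eqxx.
have := cards _ qin; rewrite /amount q0 /= => h.
suff -> : holders (state t.+1) (nth x0 sigma t) = finset.setT by rewrite inE.
apply/eqP; rewrite eqEcard finset.subsetT cardsT card_ord h.
exact: leqnn.
Qed.

Lemma alg_feasible c : feasible k sigma (run (alg c) sigma).
Proof.
rewrite /feasible all2E size_map size_iota eqxx /=.
apply/(all_nthP (x0, [::])) => t; rewrite size_zip size_map size_iota minnn => ts.
rewrite nth_zip ?size_map ?size_iota // nth_run //= requested_cached /=.
by rewrite undup_id ?uniq_cache // size_cache.
Qed.

Lemma total_alg_cost :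
  \sum_(c < 2 ^ l) alg_cost (fun p => W (cls p)) (alg c) sigma =
  \sum_(t < size sigma) move_cost W cls (pages (frac (state t.+1)))
     (holders (state t)) (holders (state t.+1)).
Proof.
rewrite /alg_cost; under eq_bigr do rewrite sched_costE size_map size_iota.
rewrite exchange_big /=; apply: eq_bigr => t _.
rewrite /move_cost.
under [RHS]eq_bigr do rewrite -sum1_card natr_sum mulr_sumr big_mkcond /=.
rewrite exchange_big /=; apply: eq_bigr => c _.
have -> : nth [::] ([::] :: run (alg c) sigma) t = cache c t.
  case: t => -[|t] ts //=; rewrite nth_run //; exact: ltnW.
rewrite nth_run // undup_id ?uniq_cache // big_filter_cond big_mkcond /=.
by apply: eq_bigr => y _; rewrite mem_cache inE mulr1 andbC.
Qed.

End Run.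

(** * Amortized cost of one step *)

Definition potential (st : fstate R P) (K : pred P) : R :=
  Acc n l st + (2 * 2 ^ l)%:R * Phi n W cls l st K.

Lemma content_widen st q : wf W cls l st ->
  \sum_(y <- pages (request q st)) W (cls y) * (amount st y)%:R = content st.
Proof.
move=> wfs; rewrite /content /=; case: ifP => // qn.
by rewrite big_cons amount_out ?qn // mulr0 add0r.
Qed.

(** What is loaded equals what is evicted plus the growth of [content], so the total change is twice
    the evictions plus that growth. *)
Lemma step_dist q e s s' : good s -> step_rel (q, e) s s' ->
  dist W cls (pages (frac s')) (amount (frac s)) (amount (frac s')) =
  2 * ecost W cls l (request q (frac s)) (frac s')
    + content (frac s') - content (frac s).
Proof.
move=> gs [_ [wf' p' q0 mono _] _] /=; have wfs := good_wf gs.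
rewrite -(content_widen q wfs) /dist /ecost /content p' mulr_sumr.
rewrite -sumrN -!big_split /=; apply: eq_bigr => y _.
have := mono y; rewrite /amount /= /upd.
have [->|yq] := eqVneq y q.
  move=> _; have := copies_le l (lev (frac s) q).
  rewrite q0 /= subnn => h; have -> : (copies l (lev (frac s) q) - 2 ^ l = 0)%N by lia.
  by rewrite add0n natrB //; lra.
move=> /(copies_anti l) h; have -> : (copies l (lev (frac s') y) -
  copies l (lev (frac s) y) = 0)%N by lia.
by rewrite addn0 natrB //; lra.
Qed.

(** The factor 6 is 3 from rounding times 2 from counting evictions twice in [step_dist]. *)
Lemma step_amortized q e s s' (K : pred P) : good s -> step_rel (q, e) s s' ->
  K q -> (count K (pages (request q (frac s))) <= k)%N ->
  exists2 K', better cls e q (pages (request q (frac s))) K K' &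
    move_cost W cls (pages (frac s')) (holders s) (holders s')
      + 6 * potential (frac s') K' - 3 * content (frac s')
    <= 6 * potential (frac s) K - 3 * content (frac s).
Proof.
move=> gs rel Kq cK; have := step_dist gs rel.
have [_ [_ _ _ _ ev] mc] := rel; move=> ed; rewrite ed in mc.
have [K' b h] := ev K Kq cK; exists K' => //.
have wfs := good_wf gs.
have := request_Acc n q wfs; have := request_Phi n wfs Kq => e1 h1.
rewrite /= in h mc *; rewrite e1 in h; rewrite /potential; lra.
Qed.

(** * Comparison with an offline schedule *)

Section Competition.
Variables (sigma : seq P) (x0 : P) (cs : seq (seq P)).
Hypothesis cs_ok : feasible k sigma cs.

Let U := undup (sigma ++ flatten cs).
Let uU : uniq U. Proof. exact: undup_uniq. Qed.

Definition opt_cache (t : nat) : pred P := fun y => y \in nth [::] ([::] :: cs) t.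

Definition weight (O : pred P) : R :=
  \sum_(y <- U) (if O y then W (cls y) else 0).

Lemma size_cs : size cs = size sigma.
Proof. by move: cs_ok; rewrite /feasible all2E => /andP[/eqP]. Qed.

Lemma cs_step t : (t < size sigma)%N ->
  opt_cache t.+1 (nth x0 sigma t) /\ (size (undup (nth [::] cs t)) <= k)%N.
Proof.
move=> ts; move: cs_ok; rewrite /feasible all2E => /andP[_].
move=> /(all_nthP (x0, [::])) /(_ t); rewrite size_zip size_cs minnn => /(_ ts).
by rewrite nth_zip ?size_cs //= => /andP[].
Qed.

Lemma opt_cache_sub t y : opt_cache t y -> y \in U.
Proof.
rewrite mem_undup mem_cat /opt_cache => h; apply/orP; right.
case: t h => [|t] //= h; apply/flattenP; exists (nth [::] cs t) => //.
by rewrite mem_nth // ltnNge; apply/negP => ht; rewrite nth_default in h.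
Qed.

Lemma opt_cache_card t : (t <= size sigma)%N -> (count (opt_cache t) U <= k)%N.
Proof.
case: t => [|t] ts; first by rewrite (@eq_count _ _ pred0) ?count_pred0.
have [_ h] := cs_step ts; apply: leq_trans h.
rewrite -size_filter; apply: uniq_leq_size; first by rewrite filter_uniq.
by move=> y; rewrite mem_filter mem_undup => /andP[].
Qed.

Lemma pages_sub t y : y \in pages (frac (state sigma x0 t)) ->
  (t <= size sigma)%N -> y \in sigma.
Proof.
elim: t => [|t IH] //; rewrite pages_step request_pages => /orP[/eqP ->|h] ts.
  exact: mem_nth.
by apply: IH => //; exact: ltnW.
Qed.

(** The potential is raised by offline evictions, but the schedule is charged for loads; the
    [weight] of its current cache is the difference. The constant is 6 from [step_amortized], times
    [2 * 2 ^ l] in [potential], times [l.+1] from [opt_move]. *)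
Lemma amortized t : (t <= size sigma)%N ->
  exists2 K, dominates cls U (page_index sigma t) K (opt_cache t) &
    \sum_(s < t) move_cost W cls (pages (frac (state sigma x0 s.+1)))
       (holders (state sigma x0 s)) (holders (state sigma x0 s.+1))
    + 6 * potential (frac (state sigma x0 t)) K
    + (12 * 2 ^ l * l.+1)%:R * weight (opt_cache t)
    <= (12 * 2 ^ l * l.+1)%:R * (\sum_(s < t) \sum_(y <- U)
         (if opt_cache s.+1 y && ~~ opt_cache s y then W (cls y) else 0))
       + 3 * content (frac (state sigma x0 t)).
Proof.
elim: t => [_|t IH ts].
  exists pred0.
    by split=> [j m|]; apply: sub_count.
  have -> : potential (frac (state sigma x0 0)) pred0 = 0.
    rewrite /potential /Acc /Phi /= !big_nil !addr0 big1; last first.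
      by move=> j _; rewrite big_ord0.
    by rewrite big1 ?mulr0 ?addr0 // => j _; rewrite big_ord0.
  have -> : weight (opt_cache 0) = 0 by rewrite /weight big1.
  by rewrite !big_ord0 /content /= big_nil !mulr0 !addr0.
have [K dK bnd] := IH (ltnW ts).
have gs := state_good sigma x0 t; have wfs := good_wf gs.
have [Oq Osize] := cs_step ts.
have [K1 d1 b1] := opt_move W_ge0 cls_lt uU (opt_cache t.+1) wfs dK.
have ds : drop t sigma = nth x0 sigma t :: drop t.+1 sigma by apply: drop_nth.
have qU : nth x0 sigma t \in U by rewrite mem_undup mem_cat mem_nth.
have [||K1q d2] := dominates_request uU qU (idx' := page_index sigma t.+1) _ _ d1 Oq.
- by rewrite /page_index ds /= eqxx.
- by move=> y yq; rewrite /page_index ds /= eq_sym (negPf yq).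
have rel := state_step (sigma := sigma) (x0 := x0) gs.
have pU : {subset pages (request (nth x0 sigma t) (frac (state sigma x0 t))) <= U}.
  move=> y; rewrite request_pages => /orP[/eqP ->//|/pages_sub h].
  by rewrite mem_undup mem_cat h // ltnW.
have up : uniq (pages (request (nth x0 sigma t) (frac (state sigma x0 t)))).
  by apply: wf_uniq (request_wf W_ge0 _ wfs).
have cK : (count K1 (pages (request (nth x0 sigma t) (frac (state sigma x0 t)))) <= k)%N.
  apply: leq_trans (opt_cache_card ts); apply: leq_trans d2.2.
  rewrite -!size_filter; apply: uniq_leq_size; first by rewrite filter_uniq.
  by move=> y; rewrite !mem_filter => /andP[-> /pU].
have [K2 bt h2] := step_amortized gs rel K1q cK.
exists K2; first by apply: (dominates_better uU _ pU bt d2).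
rewrite !big_ord_recr /=.
have ew : weight (opt_cache t.+1) + \sum_(y <- U)
    (if opt_cache t y && ~~ opt_cache t.+1 y then W (cls y) else 0) =
  weight (opt_cache t) + \sum_(y <- U)
    (if opt_cache t.+1 y && ~~ opt_cache t y then W (cls y) else 0).
  rewrite /weight -!big_split /=; apply: eq_bigr => y _.
  by case: (opt_cache t y); case: (opt_cache t.+1 y); rewrite /= ?addr0 ?add0r.
rewrite /= in h2; move: h2 bnd b1 ew; rewrite /potential !natrM.
set A := \sum_(s < t) _; set B := \sum_(s < t) _.
set mc := move_cost _ _ _ _ _; set c' := content _; set c := content _.
set w := weight _; set w' := weight _.
set ev := \sum_(y <- U) _; set ld := \sum_(y <- U) _.
set a' := Acc _ _ _; set a := Acc _ _ _.
set p2 := Phi _ _ _ _ _ K2; set p1 := Phi _ _ _ _ _ K1; set p := Phi _ _ _ _ _ K.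
set m := (2 ^ l)%:R; set L := l.+1%:R => h2 bnd b1 ew.
have m0 : 0 <= m by exact: ler0n.
have := ler_wpM2l m0 b1 => b1'.
have ew' : m * L * w' + m * L * ev = m * L * w + m * L * ld by rewrite -!mulrDr ew.
rewrite [m * (p + _)]mulrDr [m * (L * ev)]mulrA in b1'.
rewrite [_ * (A + ld)]mulrDr.
lra.
Qed.

Lemma content_le st : wf W cls l st -> (mass l st <= k * 2 ^ l)%N ->
  content st <= W 0 * (k * 2 ^ l)%:R.
Proof.
move=> wfs small; have W0 j : W j <= W 0.
  elim: j => // j IH; apply: le_trans IH; have := W_geom j; have := W_ge0 j.+1.
  rewrite mulr2n; lra.
apply: (@le_trans _ _ (W 0 * (mass l st)%:R)); last by rewrite ler_wpM2l // ler_nat.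
rewrite /content natr_sum mulr_sumr; apply: ler_sum => y _.
by rewrite ler_wpM2r ?ler0n.
Qed.

Lemma opt_cost : sched_cost (fun p => W (cls p)) [::] cs =
  \sum_(s < size sigma) \sum_(y <- U)
    (if opt_cache s.+1 y && ~~ opt_cache s y then W (cls y) else 0).
Proof.
rewrite sched_costE size_cs; apply: eq_bigr => s _.
rewrite -big_mkcond /=.
rewrite -[LHS]big_filter -[RHS]big_filter; apply: perm_big.
apply: uniq_perm; rewrite ?filter_uniq ?undup_uniq // => y.
rewrite !mem_filter mem_undup -/(opt_cache s.+1 y).
case h: (opt_cache s.+1 y); last by rewrite andbF.
by rewrite (opt_cache_sub h) andbT.
Qed.

Lemma competitive_sum :
  \sum_(c < 2 ^ l) alg_cost (fun p => W (cls p)) (alg c) sigma <=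
  (2 ^ l)%:R * ((12 * l.+1)%:R * sched_cost (fun p => W (cls p)) [::] cs
     + 3 * k%:R * W 0).
Proof.
rewrite (total_alg_cost _ x0) opt_cost.
have [K _ h] := amortized (leqnn (size sigma)).
have gs := state_good sigma x0 (size sigma); have wfs := good_wf gs.
have := content_le wfs (good_mass gs).
have p0 : 0 <= potential (frac (state sigma x0 (size sigma))) K.
  by rewrite addr_ge0 ?mulr_ge0 ?ler0n ?(Acc_ge0 _ wfs) ?(Phi_ge0 _ W_ge0 _ wfs).
have w0 : 0 <= (12 * 2 ^ l * l.+1)%:R * weight (opt_cache (size sigma)).
  by rewrite mulr_ge0 ?ler0n // sumr_ge0 // => y _; case: ifP.
move: h w0; rewrite !natrM; set A := \sum_(s < _) _; set B := \sum_(s < _) _.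
lra.
Qed.

End Competition.

End Algorithm.

(** * Reduction to geometric weights *)

From mathcomp Require Import interval_inference.
From mathcomp Require Import all_classical all_reals.
From mathcomp Require Import topology normedtype sequences exp measure
  lebesgue_measure lebesgue_integral probability.
From mathcomp Require Import ereal measurable_realfun.
Import Order.TTheory GRing.Theory Num.Theory.
Local Open Scope ring_scope.

(** * Uniform choice among finitely many algorithms *)

Section UniformProbability.
Variables (R : realType) (m : nat).
Local Open Scope ereal_scope.

Let weight_ge0 : (0 <= m.+1%:R^-1 :> R)%R.
Proof. by rewrite invr_ge0 ler0n. Qed.

Definition uniform_nat : set nat -> \bar R :=
  mscale (NngNum weight_ge0) (msum (fun i => @dirac _ nat i R) m.+1).

HB.instance Definition _ := Measure.on uniform_nat.

Let uniform_natT : uniform_nat setT = 1.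
Proof.
rewrite /uniform_nat /mscale /= /msum.
rewrite (eq_bigr (fun=> 1%:E)); last by move=> i _; exact: diracT.
by rewrite sumEFin -EFinM sumr_const card_ord mulVf ?pnatr_eq0.
Qed.

HB.instance Definition _ :=
  Measure_isProbability.Build _ _ _ uniform_nat uniform_natT.

Lemma integral_uniform_nat (f : nat -> R) : (forall i, 0 <= f i)%R ->
  \int[uniform_nat]_i (f i)%:E = (m.+1%:R^-1 * \sum_(i < m.+1) f i)%:E.
Proof.
move=> f0; have mf : @measurable_fun _ _ nat (\bar R) setT (fun i => (f i)%:E) by [].
rewrite ge0_integral_mscale //=; last by move=> i _; rewrite lee_fin.
rewrite ge0_integral_measure_sum //; last by move=> i _; rewrite lee_fin.
rewrite (eq_bigr (fun i : 'I_m.+1 => (f i)%:E)) ?sumEFin // => i _.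
have := @integral_dirac _ nat i R setT measurableT _ mf.
by rewrite diracT mul1e.
Qed.

End UniformProbability.

Section RandCompetitive.
Variables (R : realType) (P : choiceType) (w : P -> R) (k : nat).
Hypothesis w_ge0 : forall p, 0 <= w p.
Hypothesis k_gt0 : (0 < k)%N.

Lemma sched_cost_ge0 C0 cs : 0 <= sched_cost w C0 cs.
Proof.
elim: cs C0 => [|C cs IH] C0 //=; rewrite addr_ge0 //.
exact: sumr_ge0.
Qed.

Lemma OPT_nonempty (sigma : seq P) :
  nonempty [set x : R | exists cs, feasible k sigma cs /\ x = sched_cost w [::] cs].
Proof.
exists (sched_cost w [::] [seq [:: x] | x <- sigma]).
exists [seq [:: x] | x <- sigma]; split=> //.
rewrite /feasible; elim: sigma => //= x s ->.
by rewrite mem_head k_gt0.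
Qed.

Lemma OPT_ge (sigma : seq P) (x : R) :
  (forall cs, feasible k sigma cs -> x <= sched_cost w [::] cs) ->
  x <= OPT w k sigma.
Proof.
move=> h; apply: lb_le_inf; first exact: OPT_nonempty.
by move=> y [cs [fs ->]]; exact: h.
Qed.

Lemma rand_competitive_le (c c' : R) : c <= c' ->
  rand_competitive w k c -> rand_competitive w k c'.
Proof.
move=> cc' [d [Om [Pr [A [va ma [b hb]]]]]]; exists d, Om, Pr, A; split=> //.
exists b => sigma; apply: le_trans (hb sigma) _; rewrite lee_fin lerD2r.
rewrite ler_wpM2r //; apply: OPT_ge => cs _; exact: sched_cost_ge0.
Qed.

Lemma uniform_rand_competitive m (A : 'I_m.+1 -> myopic_alg P) (c b : R) :
  0 < c -> (forall i, valid_alg k (A i)) ->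
  (forall sigma cs, feasible k sigma cs ->
     \sum_i alg_cost w (A i) sigma <= m.+1%:R * (c * sched_cost w [::] cs + b)) ->
  rand_competitive w k c.
Proof.
move=> c0 vA hA; exists _, nat, (uniform_nat R m), (fun i => A (inord i)).
split=> //; exists b => sigma.
rewrite (@integral_uniform_nat R m (fun i => alg_cost w (A (inord i)) sigma)); last first.
  by move=> i; exact: sched_cost_ge0.
have -> : \sum_(i < m.+1) alg_cost w (A (inord i)) sigma = \sum_i alg_cost w (A i) sigma.
  by apply: eq_bigr => i _; rewrite inord_val.
rewrite lee_fin -lerBlDr -ler_pdivrMl //.
apply: OPT_ge => cs /hA h.
by rewrite ler_pdivrMl // lerBlDr ler_pdivrMl ?ltr0n.
Qed.

End RandCompetitive.

(** * Rounding the weights *)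

Lemma sched_cost_le (R : realType) (P : choiceType) (w1 w2 : P -> R) (a : R) C0 cs :
  (forall p, w1 p <= a * w2 p) ->
  sched_cost w1 C0 cs <= a * sched_cost w2 C0 cs.
Proof.
move=> h; elim: cs C0 => [|C cs IH] C0 /=; first by rewrite mulr0.
rewrite mulrDr lerD // mulr_sumr; exact: ler_sum.
Qed.

(** Rounding each weight down to a value within factor 2 doubles the bound for the algorithm and
    does not increase offline costs, so 12 becomes 24. *)
Lemma geometric_rand_competitive (R : realType) (P : choiceType) (w : P -> R)
    (k l : nat) (ws : seq R) :
  (0 < k)%N -> (forall v, v \in ws -> 0 <= v) ->
  sorted (fun x y => y *+ 2 <= x) ws -> (size ws <= 2 ^ l)%N ->
  (forall p, exists2 v, v \in ws & v <= w p <= 2 * v) ->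
  rand_competitive w k (24 * l.+1)%:R.
Proof.
move=> k0 ws0 srt szl cover.
pose W := nth 0 ws; pose cls p := find (fun v => v <= w p <= 2 * v) ws.
(* Beyond the list [W] is 0, which keeps it nonnegative and geometric. *)
have W_ge0 j : 0 <= W j.
  by have [h|h] := ltnP j (size ws); [apply/ws0/mem_nth|rewrite /W nth_default].
have W_geom j : W j.+1 *+ 2 <= W j.
  have [h|h] := ltnP j.+1 (size ws); last by rewrite /W nth_default // mul0rn.
  by move/(sortedP 0): srt; exact.
have has_v p : has (fun v => v <= w p <= 2 * v) ws.
  by have [v vin vw] := cover p; apply/hasP; exists v.
have cls_lt p : (cls p < size ws)%N by rewrite -has_find.
have Wcls p : W (cls p) <= w p <= 2 * W (cls p) by exact: (nth_find 0 (has_v p)).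
have w0 p : 0 <= w p by have /andP[h _] := Wcls p; exact: le_trans (W_ge0 _) h.
have M0 : (0 < 2 ^ l)%N by rewrite expn_gt0.
have eM : (2 ^ l).-1.+1 = (2 ^ l)%N by rewrite prednK.
pose A (i : 'I_(2 ^ l).-1.+1) := alg (size ws) W cls k (cast_ord eM i).
apply: (@uniform_rand_competitive R P w k w0 k0 _ A _ (6 * k%:R * W 0)).
- by rewrite ltr0n.
- move=> i [|x0 sigma]; first by [].
  exact: (alg_feasible k0 W_ge0 W_geom cls_lt szl _ x0).
move=> [|x0 sigma] cs fs.
  rewrite big1; last by move=> i _; rewrite /alg_cost /= .
  rewrite mulr_ge0 // addr_ge0 ?mulr_ge0 ?ler0n //.
  exact: sched_cost_ge0.
have := competitive_sum k0 W_ge0 W_geom cls_lt szl x0 fs.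
set s := x0 :: sigma => h.
apply: (@le_trans _ _ (2 * \sum_(c < 2 ^ l)
    alg_cost (fun p => W (cls p)) (alg (size ws) W cls k c) s)).
  rewrite mulr_sumr.
  apply: (@le_trans _ _ (\sum_(i < (2 ^ l).-1.+1)
    2 * alg_cost (fun p => W (cls p)) (A i) s)).
    apply: ler_sum => i _; apply: sched_cost_le => p.
    by have /andP[] := Wcls p.
  rewrite le_eqVlt; apply/orP; left; apply/eqP.
  rewrite (reindex (cast_ord eM)) //.
  by exists (cast_ord (esym eM)) => i _; rewrite ?cast_ordK ?cast_ordKV.
have le_opt : sched_cost (fun p => W (cls p)) [::] cs <= 1 * sched_cost w [::] cs.
  by apply: sched_cost_le => p; rewrite mul1r; have /andP[] := Wcls p.
rewrite eM; move: h le_opt; set B := \sum_(c < _) _; set o' := sched_cost _ _ _.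
set o := sched_cost _ _ _ => h le_opt.
apply: (@le_trans _ _ (2 * ((2 ^ l)%:R * ((12 * l.+1)%:R * o' + 3 * k%:R * W 0)))).
  by rewrite ler_wpM2l.
rewrite mulrCA ler_wpM2l ?ler0n //.
have : (12 * l.+1)%:R * o' <= (12 * l.+1)%:R * (1 * o) by rewrite ler_wpM2l ?ler0n.
by rewrite !natrM; lra.
Qed.

(** Greedy: half of the largest element [x0] covers all elements down to itself, and those with
    [x *+ 2 < x0] are left to the recursion. The fourth clause yields the factor 2 between
    consecutive values. *)
Lemma geometric_cover (R : realFieldType) (s : seq R) :
  (forall x, x \in s -> 0 < x) ->
  exists ws : seq R, [/\ (size ws <= size s)%N,
    sorted (fun x y => y *+ 2 <= x) ws,
    (forall v, v \in ws -> 0 <= v),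
    (forall v, v \in ws -> exists2 x, x \in s & v *+ 2 <= x)
    & forall x, x \in s -> exists2 v, v \in ws & v <= x <= 2 * v].
Proof.
have [m] := ubnP (size s); elim: m s => // m IH [|a s] hm pos.
  by exists [::]; split.
have [x0 x0s x0max] := seq_argmin (fun x : R => - x) (mem_head a s).
have x0_gt0 := pos x0 x0s.
have smaller : (size [seq x <- a :: s | (x *+ 2 < x0)%R] < size (a :: s))%N.
  rewrite size_filter -(count_predC (fun x => x *+ 2 < x0) (a :: s)) -addn1 leq_add2l.
  rewrite -has_count; apply/hasP; exists x0 => //=.
  by rewrite -leNgt mulr2n lerDl ltW.
have s'P x : (x \in [seq x <- a :: s | x *+ 2 < x0]) = (x *+ 2 < x0) && (x \in a :: s).
  exact: mem_filter.
move: smaller s'P; set s' := [seq x <- a :: s | (x *+ 2 < x0)%R] => smaller s'P.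
have [||ws [h1 h2 h3 h4 h5]] := IH s'.
- exact: leq_trans smaller _.
- by move=> x; rewrite s'P => /andP[_]; exact: pos.
exists (x0 / 2 :: ws); split.
- exact: leq_ltn_trans h1 smaller.
- case: ws h2 h4 {h1 h3 h5} => //= v ws -> /(_ v (mem_head _ _))[x].
  by rewrite s'P mulr2n andbT => /andP[+ _]; rewrite mulr2n; lra.
- by move=> v; rewrite inE => /orP[/eqP ->|/h3 //]; lra.
- move=> v; rewrite inE => /orP[/eqP ->|/h4[x + vx]].
    by exists x0 => //; rewrite mulr2n; lra.
  by rewrite s'P => /andP[_ xs]; exists x.
move=> x xs; have xx0 : x <= x0 by rewrite -lerN2 x0max.
have [lt|ge] := ltP (x *+ 2) x0.
  have [|v vin vx] := h5 x; first by rewrite s'P lt xs.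
  by exists v => //; rewrite inE vin orbT.
exists (x0 / 2); first exact: mem_head.
by rewrite mulr2n in ge; apply/andP; split; lra.
Qed.

(** * Logarithmic estimates and the final constants *)

Lemma ln2_bounds (R : realType) : 1 / 2 <= ln (2 : R) <= 1.
Proof.
apply/andP; split; last by have := @le_ln1Dx R 1; rewrite -[1 + 1]/(2); apply; lra.
have := @le_ln1Dx R (- (1 / 2)).
have -> : 1 + - (1 / 2) = 2^-1 :> R by lra.
by rewrite lnV ?posrE // => /(_ _); lra.
Qed.

Lemma pow2_le_ln (R : realType) (m : nat) (x : R) :
  2 ^+ m <= x -> m%:R <= 2 * ln x.
Proof.
move=> h; have p : 0 < 2 ^+ m :> R by rewrite exprn_gt0.
have : ln (2 ^+ m) <= ln x by rewrite ler_ln ?posrE // (lt_le_trans p).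
rewrite lnXn // -[ln 2 *+ m]mulr_natl => hm.
have /andP[l2 _] := ln2_bounds R.
have : m%:R * (1 / 2) <= m%:R * ln 2 :> R by rewrite ler_wpM2l.
lra.
Qed.

Lemma trunc_log_le_ln (R : realType) (n : nat) :
  (trunc_log 2 n)%:R <= 2 * ln (n%:R : R).
Proof.
case: n => [|n]; first by rewrite ln0 // mulr0.
apply: pow2_le_ln; rewrite -natrX ler_nat; exact: trunc_logP.
Qed.

Lemma pow2_bracket (R : realType) (x : R) : 1 <= x ->
  exists m, 2 ^+ m <= x < 2 ^+ m.+1.
Proof.
move=> x1; have x0 : 0 <= x by lra.
exists (trunc_log 2 (Num.truncn x)); rewrite -!natrX.
have t0 : (0 < Num.truncn x)%N by rewrite truncn_ge_nat.
by rewrite -truncn_ge_nat // trunc_logP //= -truncn_lt_nat // trunc_log_ltn.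
Qed.

Lemma log_classes_competitive (R : realType) (P : choiceType) (w : P -> R)
    (k n : nat) (ws : seq R) :
  (0 < k)%N -> (forall v, v \in ws -> 0 <= v) ->
  sorted (fun x y => y *+ 2 <= x) ws -> (size ws <= n)%N ->
  (forall p, exists2 v, v \in ws & v <= w p <= 2 * v) ->
  rand_competitive w k (48 * (1 + ln (n%:R : R))).
Proof.
move=> k0 ws0 srt szn cover.
have w0 p : 0 <= w p.
  by have [v vin /andP[h _]] := cover p; exact: le_trans (ws0 v vin) h.
apply: (@rand_competitive_le R P w k w0 k0 (24 * (trunc_log 2 n).+2)%:R).
  have := trunc_log_le_ln R n; rewrite natrM -addn2 natrD; lra.
apply: (geometric_rand_competitive k0 ws0 srt _ cover).
by apply: leq_trans szn _; rewrite ltnW // trunc_log_ltn.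
Qed.

Theorem theorem2 :
  exists C : nat, (0 < C)%N /\
  forall (R : realType) (P : choiceType) (w : P -> R) (k : nat),
    (0 < k)%N -> (forall p, 0 < w p) ->
    (forall l : nat, weight_classes w l ->
       rand_competitive w k (C%:R * (1 + ln (l%:R : R))))
    /\
    (forall W : R, 1 <= W -> (forall p, 1 <= w p <= W) ->
       rand_competitive w k (C%:R * (1 + ln (1 + ln W)))).
Proof.
(* With at most [N.+1] geometric weights and [N <= 2 * ln W], [ln N.+1%:R] is at most
   [1 + ln (1 + ln W)]; the extra 1 doubles the constant 48. *)
exists 96%N; split=> // R P w k k0 w_gt0.
have w_ge0 p : 0 <= w p by exact: ltW.
split=> [l [s [_ <- ws sw]]|W W1 wW].
  have [|vs [h1 h2 h3 _ h5]] := geometric_cover (s := s).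
    by move=> x /sw[p <-].
  have := log_classes_competitive (w := w) k0 h3 h2 h1 (fun p => h5 _ (ws p)).
  apply: rand_competitive_le => //.
  have ln_ge : 0 <= ln (size s)%:R :> R.
    (* Zero classes can only occur without pages; there [ln 0 = 0]. *)
    by case: (size s) => [|m]; [rewrite ln0|rewrite ln_ge0 // ler1n].
  lra.
have [N /andP[NW WN]] := pow2_bracket W1.
(* The powers of 2 from [2 ^+ N] down to 1 cover every weight in [[1, W]] within factor 2. *)
pose vs : seq R := [seq 2 ^+ (N - i) | i <- iota 0 N.+1].
have h : rand_competitive w k (48 * (1 + ln (N.+1%:R : R))).
  apply: (@log_classes_competitive _ _ _ _ _ vs) => //.
  - by move=> v /mapP[i _ ->]; rewrite exprn_ge0.
  - apply/(sortedP 0) => i; rewrite size_map size_iota => iN.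
    rewrite !(nth_map 0%N) ?size_iota ?(ltnW iN) // !nth_iota ?(ltnW iN) // !add0n.
    by rewrite -[(N - i)%N]subnSK // exprS mulr2n; lra.
  - by rewrite size_map size_iota.
  move=> p; have /andP[wp1 wpW] := wW p.
  have [j /andP[jw wj]] := pow2_bracket wp1.
  have jN : (j < N.+1)%N.
    have : (2 ^ j < 2 ^ N.+1)%N.
      rewrite -(ltr_nat R) !natrX; apply: le_lt_trans jw _.
      exact: le_lt_trans wpW WN.
    by rewrite ltn_exp2l.
  exists (2 ^+ j); last by rewrite jw -exprS ltW.
  apply/mapP; exists (N - j)%N; first by rewrite mem_iota; lia.
  by rewrite subKn.
apply: rand_competitive_le h => //.
have lnW : 0 <= ln W by exact: ln_ge0.
have N_le := pow2_le_ln NW.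
have /andP[_ l2] := ln2_bounds R.
have l1W : 0 <= ln (1 + ln W) by rewrite ln_ge0 // lerDl.
have : ln N.+1%:R <= ln (2 * (1 + ln W)).
  by rewrite ler_ln ?posrE ?ltr0n // -?natr1; lra.
rewrite lnM ?posrE //; lra.
Qed.
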